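(* Let $\psi\in L^1(\mathbb{R}^d)\cap L^2(\mathbb{R}^d)$ satisfy $$0<c=\sum_{k\in\mathbb{Z}^d}\inf_{x\in[0,1)^d}|\hat\psi(x+k)|^2<\sum_{k\in\mathbb{Z}^d}\sup_{x\in[0,1)^d}|\hat\psi(x+k)|^2=C<\infty .$$ Let $X=\{x_n\}_{n\in\mathbb{Z}^d}$ be a countable discrete subset of $\mathbb{R}^d$ such that $\{e^{2\pi i x_n\cdot x}\}_{n\in\mathbb{Z}^d}$ is a Riesz basis of $L^2([0,1)^d)$, and suppose that $\{\tau_{x_n}\psi\}_{n\in\mathbb{Z}^d}$ is a $2$-Riesz basis of $V^2(\psi;X)$. Then there exists $\delta>0$ such that for every $Y=\{y_n\}_{n\in\mathbb{Z}^d}\subset\mathbb{R}^d$ with $\sup_n|y_n-x_n|_2<\delta$, the set $\{\tau_{y_n}\psi\}_{n\in\mathbb{Z}^d}$ is a $2$-Riesz basis of $V^2(\psi;Y)$.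
   Context: $\tau_s f(x)=f(x+s)$ denotes translation; $|\cdot|_2$ is the Euclidean norm on $\mathbb{R}^d$. The Fourier transform is $\hat\psi(y)=\int_{\mathbb{R}^d}e^{2\pi i x\cdot y}\psi(x)\,dx$. A countable set $X=\{x_j\}\subset\mathbb{R}^d$ is discrete if for every $x_j\in X$ there exists $\delta_j>0$ such that $|x_j-x_k|_2>\delta_j$ for every $k\neq j$. For $X=\{x_j\}_{j\in\mathbb{Z}^d}\subset\mathbb{R}^d$, $V^2(\psi;X)$ is the closure in $L^2(\mathbb{R}^d)$ of $\mathrm{Span}\{\tau_{x_j}\psi\}_{j\in\mathbb{Z}^d}$. The translates $\{\tau_{x_j}\psi\}_{j\in\mathbb{Z}^d}$ form a $2$-Riesz basis of $V^2(\psi;X)$ if there exist constants $A,B>0$ such that for every finite set of coefficients $\vec d=\{d_j\}\subset\mathbb{C}$, $A\|\vec d\|_{\ell^2}\le\|\sum_j d_j\tau_{x_j}\psi\|_2\le B\|\vec d\|_{\ell^2}$. A Riesz basis of $L^2([0,1)^d)$ is a family with dense linear span satisfying the analogous two-sided inequality in the norm of $L^2([0,1)^d)$. *)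

(* Defs.v *)
From HB Require Import structures.
From mathcomp Require Import all_boot all_order all_algebra finmap.
From mathcomp Require Import all_classical all_reals all_analysis.
From mathcomp.real_closed Require Import complex.
Import Order.TTheory GRing.Theory Num.Theory.
Import ComplexField.Normc.

Set Implicit Arguments.
Unset Strict Implicit.
Unset Printing Implicit Defensive.

Local Open Scope classical_set_scope.
Local Open Scope ring_scope.
Local Open Scope complex_scope.

Definition measure_rV_display : measure_display -> measure_display.
Proof. exact. Qed.

(* The sigma-algebra on row vectors is the product one, generated by the
   coordinate maps; on 'rV[R]_n it is the Borel sigma-algebra of R^n. *)
Section measurable_rV.
Context {d} {T : measurableType d}.
Variable n : nat.

Let coors : 'I_n -> 'rV[T]_n -> T := fun i v => v ord0 i.

Let rV_set0 : g_sigma_preimage coors set0.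
Proof. exact: sigma_algebra0. Qed.

Let rV_setC A : g_sigma_preimage coors A -> g_sigma_preimage coors (~` A).
Proof. exact: sigma_algebraC. Qed.

Let rV_bigcup (F : _^nat) : (forall i, g_sigma_preimage coors (F i)) ->
  g_sigma_preimage coors (\bigcup_i (F i)).
Proof. exact: sigma_algebra_bigcup. Qed.

HB.instance Definition _ := @isMeasurable.Build (measure_rV_display d)
  'rV[T]_n (g_sigma_preimage coors) rV_set0 rV_setC rV_bigcup.

End measurable_rV.

Section measurable_rV_theory.
Context {d d'} {T : measurableType d} {U : measurableType d'}.

Lemma measurable_coord_rV n (i : 'I_n) :
  measurable_fun [set: 'rV[T]_n] (fun v => v ord0 i).
Proof.
move=> _ Y mY; rewrite setTI; apply: sub_sigma_algebra => /=.
rewrite -bigcup_seq/=; exists i => /=; first by rewrite mem_index_enum.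
by exists Y => //; rewrite setTI.
Qed.

Lemma measurable_fun_rVP n (f : U -> 'rV[T]_n) :
  measurable_fun [set: U] f <->
  forall i, measurable_fun [set: U] (fun u => f u ord0 i).
Proof.
split=> [mf i|mf]; first exact: measurableT_comp (measurable_coord_rV i) mf.
apply: (@measurability _ _ _ _ _ f
  (\big[setU/set0]_(i < n) preimage_set_system setT
    (fun v : 'rV[T]_n => v ord0 i) measurable)) => //.
move=> _ [B + <-]; rewrite -bigcup_seq/= => -[i _ [A mA <-]].
by rewrite setTI -comp_preimage; exact: mf.
Qed.

Lemma measurable_rV_box n (A : 'I_n -> set T) : (forall i, measurable (A i)) ->
  measurable [set v : 'rV[T]_n | forall i, A i (v ord0 i)].
Proof.
move=> mA; rewrite (_ : mkset _ = \bigcap_(i in [set: 'I_n])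
    ((fun v : 'rV[T]_n => v ord0 i) @^-1` A i)); last first.
  by apply/seteqP; split => v vA i; [move=> _|]; exact: vA.
apply: fin_bigcap_measurable => // i _.
by rewrite -[X in measurable X]setTI; exact: measurable_coord_rV.
Qed.

End measurable_rV_theory.

Section lebesgue_rV.
Context {R : realType}.

Definition cons_rV n (p : R * 'rV[R]_n) : 'rV[R]_n.+1 := row_mx p.1%:M p.2.

Definition uncons_rV n (v : 'rV[R]_n.+1) : R * 'rV[R]_n :=
  (v ord0 ord0, @rsubmx _ 1 1 n v).

Lemma cons_rVK n : cancel (@cons_rV n) (@uncons_rV n).
Proof.
move=> [a v]; rewrite /uncons_rV /cons_rV /= row_mxKr; congr (_, _).
have -> : (ord0 : 'I_n.+1) = lshift n (ord0 : 'I_1) by exact: val_inj.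
by have /= -> := @row_mxEl _ _ _ _ a%:M v ord0 ord0; rewrite mxE eqxx.
Qed.

Lemma cons_rV0 n p : cons_rV p ord0 (ord0 : 'I_n.+1) = p.1.
Proof. by rewrite -[in RHS](cons_rVK p). Qed.

Lemma cons_rV_lift n p (i : 'I_n) : cons_rV p ord0 (lift ord0 i) = p.2 ord0 i.
Proof. by rewrite -rshift1; exact: row_mxEr. Qed.

Lemma measurable_cons_rV n : measurable_fun setT (@cons_rV n).
Proof.
apply/measurable_fun_rVP => i; case: (unliftP ord0 i) => [j ->|->].
  under eq_fun do rewrite cons_rV_lift.
  exact: measurableT_comp (measurable_coord_rV j) measurable_snd.
under eq_fun do rewrite cons_rV0.
exact: measurable_fst.
Qed.

Lemma measurable_uncons_rV n : measurable_fun setT (@uncons_rV n).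
Proof.
apply/measurable_fun_pairP; split; first exact: measurable_coord_rV.
apply/measurable_fun_rVP => i /=.
under eq_fun do rewrite mxE.
exact: measurable_coord_rV.
Qed.

Section step.
Variables (n : nat) (m : {sigma_finite_measure set 'rV[R]_n -> \bar R}).

Definition lebesgue_rV_step : set 'rV[R]_n.+1 -> \bar R :=
  pushforward (@lebesgue_measure R \x m)%E (@cons_rV n).

Let step0 : lebesgue_rV_step set0 = 0%E.
Proof. by rewrite /lebesgue_rV_step /pushforward preimage_set0 measure0. Qed.

Let step_ge0 A : (0 <= lebesgue_rV_step A)%E.
Proof. by rewrite /lebesgue_rV_step /pushforward measure_ge0. Qed.

Let step_sigma_additive : semi_sigma_additive lebesgue_rV_step.
Proof.
have mf := @measurable_cons_rV n.
move=> F mF tF mUF; rewrite /lebesgue_rV_step /pushforward preimage_bigcup.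
apply: measure_semi_sigma_additive.
- by move=> k; rewrite -[X in measurable X]setTI; exact: mf.
- apply/trivIsetP => /= i j _ _ ij; rewrite -preimage_setI.
  by move/trivIsetP : tF => /(_ _ _ _ _ ij) ->//; rewrite preimage_set0.
- by rewrite -preimage_bigcup -[X in measurable X]setTI; exact: mf.
Qed.

HB.instance Definition _ := isMeasure.Build _ _ _ lebesgue_rV_step
  step0 step_ge0 step_sigma_additive.

Let step_sigma_finite : sigma_finite setT lebesgue_rV_step.
Proof.
have /sigma_finiteP[F [TF ndF Foo]] := sigma_finiteT (@lebesgue_measure R).
have /sigma_finiteP[G [TG ndG Goo]] := sigma_finiteT m.
have TFG : setT = \bigcup_k (F k `*` G k).
  rewrite -setXTT TF TG predeqE => -[x y]; split.
    move=> [/= [k _ Fkx] [l _ Gly]]; exists (maxn k l) => //; split.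
    - by move: x Fkx; exact/subsetPset/ndF/leq_maxl.
    - by move: y Gly; exact/subsetPset/ndG/leq_maxr.
  by move=> [k _ []/= ? ?]; split; exists k.
exists (fun k => @uncons_rV n @^-1` (F k `*` G k)).
  by rewrite -preimage_bigcup -TFG preimage_setT.
move=> k; have [mF ?] := Foo k; have [mG ?] := Goo k; split.
  rewrite -[X in measurable X]setTI; apply: measurable_uncons_rV => //.
  exact: measurableX.
rewrite /lebesgue_rV_step /pushforward -comp_preimage.
rewrite (_ : _ \o _ = id) ?preimage_id; last exact/funext/cons_rVK.
by rewrite product_measure1E// lte_mul_pinfty// ge0_fin_numE.
Qed.

HB.instance Definition _ := Measure_isSigmaFinite.Build _ _ _ lebesgue_rV_step
  step_sigma_finite.

End step.

(* R^0 is a point, of mass 1, and the Lebesgue measure of R^n.+1 is the product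
   of the one of R by the one of R^n, transported along cons_rV. *)
Fixpoint lebesgue_rV n : {sigma_finite_measure set 'rV[R]_n -> \bar R} :=
  if n is n'.+1 then lebesgue_rV_step (lebesgue_rV n') else \d_(0 : 'rV[R]_0).

Lemma lebesgue_rV_box n (A : 'I_n -> set R) : (forall i, measurable (A i)) ->
  lebesgue_rV n [set v : 'rV[R]_n | forall i, A i (v ord0 i)] =
  (\prod_(i < n) lebesgue_measure (A i))%E.
Proof.
elim: n A => [|n IHn] A mA.
  rewrite big_ord0 /= diracE mem_set//=; by case.
rewrite big_ord_recl /= -IHn; last by move=> i; exact: mA.
rewrite -product_measure1E//; last first.
- exact: (@measurable_rV_box _ R _ (fun i => A (lift ord0 i))).
- exact: (mA ord0).
rewrite /lebesgue_rV_step /pushforward; congr ((_ \x _)%E _).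
apply/seteqP; split => [p /= Ap|p /= [Ap0 Ap] i].
  split=> [|i /=]; first by have := Ap ord0; rewrite cons_rV0.
  by have := Ap (lift ord0 i); rewrite cons_rV_lift.
case: (unliftP ord0 i) => [j ->|->]; first by rewrite cons_rV_lift; exact: Ap.
by rewrite cons_rV0.
Qed.

End lebesgue_rV.
Arguments lebesgue_rV {R} n.

(* [Lnorm] and [\int] are real-valued notions: complex-valued functions go
   through their modulus, or through their real and imaginary parts. *)
Section complex_valued.
Context d {T : measurableType d} {R : realType}.
Variable mu : {measure set T -> \bar R}.
Implicit Types (D : set T) (f g : T -> R[i]) (V : set (T -> R[i])).

Definition cmeasurable_fun D f :=
  measurable_fun D (fun t => complex.Re (f t)) /\
  measurable_fun D (fun t => complex.Im (f t)).

Definition cintegral D f : R[i] :=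
  (\int[mu]_(t in D) complex.Re (f t)) +i* (\int[mu]_(t in D) complex.Im (f t)).

Definition cLnorm (p : \bar R) D f : \bar R :=
  'N[mu]_p[(fun t => (normc (f t))%:E) \_ D]%E.

Definition cLspace (p : \bar R) D : set (T -> R[i]) :=
  [set f | cmeasurable_fun D f /\ (cLnorm p D f < +oo)%E].

Section family.
Context {I : choiceType}.
Implicit Types (e : I -> T -> R[i]) (J : {fset I}) (a : I -> R[i]).

Definition lincomb e J a : T -> R[i] := fun t => \sum_(j <- J) a j * e j t.

(* The elements of cLspace are functions, not classes, so that this closure is
   saturated for equality almost everywhere on D. *)
Definition closed_span D e : set (T -> R[i]) :=
  [set f | cLspace 2%:E D f /\
    forall eps : R, 0 < eps -> exists J a,
      (cLnorm 2%:E D (fun t => f t - lincomb e J a t)%R < eps%:E)%E].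

Definition l2norm J a : R := Num.sqrt (\sum_(j <- J) normc (a j) ^+ 2).

Definition riesz_bounds D e := exists A B : R, [/\ 0 < A, 0 < B &
  forall J a,
    ((A * l2norm J a)%:E <= cLnorm 2%:E D (lincomb e J a))%E /\
    (cLnorm 2%:E D (lincomb e J a) <= (B * l2norm J a)%:E)%E].

(* For V := closed_span D e the first conjunct holds by reflexivity; for V the
   whole L^2(D) it says that the linear span of e is dense. *)
Definition riesz_basis D V e := closed_span D e = V /\ riesz_bounds D e.

End family.
End complex_valued.

Section euclidean.
Context {R : realType} {d : nat}.
Implicit Types (x y s : 'rV[R]_d) (psi : 'rV[R]_d -> R[i]).
Implicit Types X : 'rV[int]_d -> 'rV[R]_d.

Definition dotp x y : R := \sum_(i < d) x ord0 i * y ord0 i.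

Definition enorm x : R := Num.sqrt (\sum_(i < d) x ord0 i ^+ 2).

(* e^{2 pi i t} *)
Definition expi2pi (t : R) : R[i] := cos (2 * pi * t) +i* sin (2 * pi * t).

Definition fourier psi y : R[i] :=
  cintegral (lebesgue_rV d) setT (fun x => expi2pi (dotp x y) * psi x).

Definition translate s psi : 'rV[R]_d -> R[i] := fun x => psi (x + s).

Definition ucube : set 'rV[R]_d := [set x | forall i, 0 <= x ord0 i < 1].

Definition rV_of_int (k : 'rV[int]_d) : 'rV[R]_d := map_mx intr k.

Definition discrete_family X :=
  forall j, exists2 delta : R, 0 < delta &
    forall k, k != j -> delta < enorm (X j - X k).

Definition translates psi X : 'rV[int]_d -> 'rV[R]_d -> R[i] :=
  fun n => translate (X n) psi.

Definition V2 psi X : set ('rV[R]_d -> R[i]) :=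
  closed_span (lebesgue_rV d) setT (translates psi X).

Definition translates_riesz_basis psi X :=
  riesz_basis (lebesgue_rV d) setT (V2 psi X) (translates psi X).

Definition exponentials X : 'rV[int]_d -> 'rV[R]_d -> R[i] :=
  fun n t => expi2pi (dotp (X n) t).

Definition exponentials_riesz_basis X :=
  riesz_basis (lebesgue_rV d) ucube
    (cLspace (lebesgue_rV d) 2%:E ucube) (exponentials X).

(* The sums are over Z^d and take values in [0, +oo]. *)
Definition sum_inf_fourier psi : \bar R :=
  (\esum_(k in [set: 'rV[int]_d])
    ereal_inf [set (normc (fourier psi (x + rV_of_int k)) ^+ 2)%:E | x in ucube])%E.

Definition sum_sup_fourier psi : \bar R :=
  (\esum_(k in [set: 'rV[int]_d])
    ereal_sup [set (normc (fourier psi (x + rV_of_int k)) ^+ 2)%:E | x in ucube])%E.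

End euclidean.

(* Main.v *)
Require Import Defs.
From mathcomp Require Import all_boot all_order all_algebra finmap.
From mathcomp Require Import all_classical all_reals all_analysis.
From mathcomp.real_closed Require Import complex.
From mathcomp Require Import measurable_realfun ring lra.
Import Order.TTheory GRing.Theory Num.Theory.
Import numFieldNormedType.Exports.
Import ComplexField.Normc.

Local Open Scope classical_set_scope.
Local Open Scope ring_scope.
Local Open Scope complex_scope.

Set Implicit Arguments.
Unset Strict Implicit.
Unset Printing Implicit Defensive.

(** What has to be shown is that, for y close enough to x,
      f = \sum_j a_j (tau_(y_j) psi - tau_(x_j) psi)
    satisfies |f|_2 <= eta |a|_2, with eta half of the lower Riesz bound of the
    translates by x ([translates_perturbation]): the triangle inequality then gives
    both bounds for the translates by y.

    The Fourier transform of f is E psi^, where, up to conjugation, E is the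
    trigonometric sum \sum_j conj(a_j) (e(y_j . xi) - e(x_j . xi)). Plancherel's
    inequality |f|_2 <= |f^|_2 ([plancherel_le]) and the partition of R^d into the
    cubes k + [0,1)^d ([integral_cells_le]) give
      |f|_2^2 <= \sum_k sup_cube |psi^(. + k)|^2 int_cube |E(t + k)|^2 dt.
    Since the sum C of the suprema is finite, all but finitely many k contribute
    little, provided that the integrals of |E(t + k)|^2 over the cube are bounded by
    a constant times |a|_2^2 independently of k: this is so because shifting by k
    only multiplies the coefficients by numbers of modulus one
    ([trig_diff_bounded]). For the finitely many remaining k the integral itself is
    small when y is close to x ([trig_diff_small]).

    Both facts rest on a perturbation argument of Paley-Wiener and Duffin-Eachus
    type ([exponential_perturbation]): expanding e(z_j . tau) - 1 in a power
    series, the m-th term is a sum of exponentials at the frequencies x_j whose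
    coefficients have been multiplied by monomials in the coordinates of the
    small vectors z_j = y_j - x_j, and the upper bound on the exponentials at x
    applies to it.

    Plancherel's inequality, for f integrable on R^d and with both sides allowed
    to be infinite, is proved by induction on d, transforming one variable at a
    time. On the line, for a bounded continuous integrable g, the integral of
    |g^|^2 exp(-2 pi eps |xi|) is the double integral of g(x) g(y) against the
    Poisson kernel at x - y, and tends to the integral of g^2 as eps tends to 0
    ([plancherel_le_bounded]). For a general integrable f, this is applied to the
    averages of f over small intervals, whose transforms are those of f times
    factors of modulus at most 1, and which converge to f almost everywhere by
    Lebesgue's differentiation theorem ([plancherel_le_real]). *)

(** * Integrable real functions and Fubini's theorem *)

Notation L1 mu f := (mu.-integrable setT (fun x => (f x)%:E)).

Section integrable_real.
Context d (T : measurableType d) (R : realType) (mu : {measure set T -> \bar R}).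
Implicit Types f g : T -> R.

Lemma L1_measurable f : L1 mu f -> measurable_fun setT f.
Proof. by move=> /measurable_int/measurable_EFinP. Qed.

Lemma L1_le f g : measurable_fun setT f -> (forall x, `|f x| <= g x) ->
  L1 mu g -> L1 mu f.
Proof.
move=> mf fg; apply: le_integrable => //; first exact/measurable_EFinP.
by move=> x _ /=; rewrite lee_fin (le_trans (fg x))// ler_norm.
Qed.

Lemma L1_fin f : measurable_fun setT f ->
  (\int[mu]_x (`|f x|)%:E < +oo)%E -> L1 mu f.
Proof. by move=> mf foo; apply/integrableP; split => //; exact/measurable_EFinP. Qed.

Lemma L1_bounded (M : R) f (k : T -> R) : L1 mu f -> measurable_fun setT k ->
  (forall x, `|k x| <= M) -> L1 mu (fun x => f x * k x).
Proof.
move=> f1 mk kM.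
have mf := L1_measurable f1.
apply: (L1_le (g := fun x => M * `|f x|)); first exact: measurable_funM.
  by move=> x; rewrite normrM mulrC ler_wpM2r.
have := integrable_norm f1.
move/(integrableZl measurableT M); apply: eq_integrable => //.
Qed.

Lemma L1D f g : L1 mu f -> L1 mu g -> L1 mu (fun x => f x + g x).
Proof. by move=> f1 g1; have := integrableD measurableT f1 g1; apply: eq_integrable. Qed.

Lemma L1B f g : L1 mu f -> L1 mu g -> L1 mu (fun x => f x - g x).
Proof. by move=> f1 g1; have := integrableB measurableT f1 g1; apply: eq_integrable. Qed.

Lemma L1Z (c : R) f : L1 mu f -> L1 mu (fun x => c * f x).
Proof. by move=> f1; have := integrableZl measurableT c f1; apply: eq_integrable. Qed.

Lemma L1_norm f : L1 mu f -> L1 mu (fun x => `|f x|).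
Proof. exact: integrable_norm. Qed.

Lemma EFin_Rintegral f : L1 mu f -> (\int[mu]_x f x)%:E = (\int[mu]_x (f x)%:E)%E.
Proof. by move=> f1; rewrite fineK// integrable_fin_num. Qed.

Lemma Rintegral_add f g : L1 mu f -> L1 mu g ->
  \int[mu]_x (f x + g x) = \int[mu]_x f x + \int[mu]_x g x.
Proof. by move=> f1 g1; rewrite RintegralD. Qed.

Lemma Rintegral_sub f g : L1 mu f -> L1 mu g ->
  \int[mu]_x (f x - g x) = \int[mu]_x f x - \int[mu]_x g x.
Proof. by move=> f1 g1; rewrite RintegralB. Qed.

Lemma Rintegral_scale (c : R) f : L1 mu f ->
  \int[mu]_x (c * f x) = c * \int[mu]_x f x.
Proof. by move=> f1; rewrite RintegralZl. Qed.

End integrable_real.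

Section product_integrals.
Context d1 d2 (T1 : measurableType d1) (T2 : measurableType d2) (R : realType).
Variables (m1 : {sigma_finite_measure set T1 -> \bar R})
          (m2 : {sigma_finite_measure set T2 -> \bar R}).
Implicit Type h : T1 * T2 -> R.

(** The positive and the negative part have measurable partial integrals; no
    integrability is involved, infinite values being sent to 0 by [fine]. *)
Lemma measurable_Rintegral_param h : measurable_fun setT h ->
  measurable_fun setT (fun x => \int[m2]_y h (x, y)).
Proof.
move=> mh; apply: (measurableT_comp (fine_measurable measurableT)).
have mE : measurable_fun setT (EFin \o h) by exact/measurable_EFinP.
rewrite (_ : (fun x => _) = fun x => (\int[m2]_y (EFin \o h)^\+ (x, y) -
   \int[m2]_y (EFin \o h)^\- (x, y))%E); last first.
  apply/funext => x; rewrite integralE; congr (_ - _)%E;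
    by apply: eq_integral => y _; rewrite !(funeposE, funenegE).
apply: emeasurable_funB.
  exact: (measurable_fun_fubini_tonelli_F _ (measurable_funepos mE)).
exact: (measurable_fun_fubini_tonelli_F _ (measurable_funeneg mE)).
Qed.

(** The joint integrability needed to exchange two integrals, for integrands
    dominated by a tensor product. *)
Lemma L1_prod (M : R) f g h : L1 m1 f -> L1 m2 g -> measurable_fun setT h ->
  (forall x y, `|h (x, y)| <= M * `|f x| * `|g y|) -> L1 (m1 \x m2)%E h.
Proof.
move=> f1 g1 mh hM.
apply/integrable12ltyP; first exact/measurable_EFinP.
have mf := L1_measurable f1; have mg := L1_measurable g1.
have /integrableP[_ foo] := f1.
have /integrableP[_ goo] := g1.
apply: (@le_lt_trans _ _ (\int[m1]_x \int[m2]_y ((`|M| * `|f x|)%:E * `|(g y)%:E|))%E).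
  apply: ge0_le_integral => //.
  - by move=> x _; exact: integral_ge0.
  - apply: (measurable_fun_fubini_tonelli_F (m2 := m2) (fun z => `|(h z)%:E|)%E) => //.
    by apply: measurableT_comp => //; exact/measurable_EFinP.
  - rewrite (_ : (fun x => _) = (fun x => (`|M| * `|f x|)%:E * \int[m2]_y `|(g y)%:E|)%E).
      apply: emeasurable_funM => //; apply/measurable_EFinP.
      by apply: measurable_funM => //; exact: measurableT_comp.
    apply/funext => x; rewrite ge0_integralZl//.
    + by apply: measurableT_comp => //; exact/measurable_EFinP.
  move=> x _; apply: ge0_le_integral => //.
  - by apply: measurableT_comp => //; apply/measurable_EFinP; exact: measurableT_comp.
  - apply: emeasurable_funM => //.
    by apply: measurableT_comp => //; exact/measurable_EFinP.
  - move=> y _; rewrite -EFinM lee_fin (le_trans (hM x y))// !ler_wpM2r//.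
    exact: ler_norm.
under eq_integral => x _.
  rewrite ge0_integralZl//; last first.
    by apply: measurableT_comp => //; exact/measurable_EFinP.
  over.
rewrite ge0_integralZr//.
- under eq_integral do rewrite EFinM.
  rewrite ge0_integralZl//.
  + rewrite lte_mul_pinfty ?mule_ge0 ?integral_ge0//.
    by rewrite ge0_fin_numE ?mule_ge0 ?integral_ge0// lte_mul_pinfty.
  + by apply/measurable_EFinP; exact: measurableT_comp.
- by apply/measurable_EFinP; apply: measurable_funM => //; exact: measurableT_comp.
- exact: integral_ge0.
Qed.

Lemma L1_Rintegral1 h : L1 (m1 \x m2)%E h -> L1 m1 (fun x => \int[m2]_y h (x, y)).
Proof.
move=> h1; have mh := L1_measurable h1.
apply: L1_fin; first exact: measurable_Rintegral_param.
have /integrable12ltyP := h1.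
move=> /(_ (measurable_int _ h1)); apply: le_lt_trans.
apply: ge0_le_integral => //.
- by apply/measurable_EFinP; apply: measurableT_comp => //; exact: measurable_Rintegral_param.
- apply: (measurable_fun_fubini_tonelli_F (m2 := m2) (fun z => `|(h z)%:E|)%E) => //.
  by apply: measurableT_comp => //; exact/measurable_EFinP.
- move=> x _.
  apply: (@le_trans _ _ `|\int[m2]_y (h (x, y))%:E|%E).
    rewrite /Rintegral.
    by case: (\int[m2]_y (h (x, y))%:E)%E => [r||] /=; rewrite ?normr0 ?lexx ?leey.
  apply: le_abse_integral => //; apply/measurable_EFinP; exact: measurableT_comp.
Qed.

(** The two sides only differ at the points whose section is not integrable,
    where [fine] replaces an infinite or undefined partial integral by 0; by
    Fubini's theorem these points are negligible. *)
Lemma Rintegral12 h : L1 (m1 \x m2)%E h ->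
  \int[m1]_x \int[m2]_y h (x, y) = \int[(m1 \x m2)%E]_z h z.
Proof.
move=> h1; have mh := L1_measurable h1.
rewrite [RHS]/Rintegral -integral12_prod_meas1// [LHS]/Rintegral; congr fine.
apply: ae_eq_integral => //.
- by apply/measurable_EFinP; exact: measurable_Rintegral_param.
- exact: (measurable_fubini_F h1).
have := ae_integrable1 h1; apply: filterS => x h1x _.
by rewrite EFin_Rintegral.
Qed.

Lemma Rintegral21 h : L1 (m1 \x m2)%E h ->
  \int[m2]_y \int[m1]_x h (x, y) = \int[(m1 \x m2)%E]_z h z.
Proof.
move=> h1; have mh := L1_measurable h1.
rewrite [RHS]/Rintegral -integral21_prod_meas1// [LHS]/Rintegral; congr fine.
apply: ae_eq_integral => //.
- apply/measurable_EFinP.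
  apply: (measurableT_comp (fine_measurable measurableT)).
  exact: (measurable_fubini_G h1).
- exact: (measurable_fubini_G h1).
have := ae_integrable2 h1; apply: filterS => x h1x _.
by rewrite EFin_Rintegral.
Qed.

Lemma Rintegral_swap h : L1 (m1 \x m2)%E h ->
  \int[m1]_x \int[m2]_y h (x, y) = \int[m2]_y \int[m1]_x h (x, y).
Proof. by move=> h1; rewrite Rintegral12// Rintegral21. Qed.

End product_integrals.
(** * Affine changes of variable on the line *)

(** The measure structure of the image measure depends on the measurability of
    the map, which is made an explicit argument here. *)
Definition image_measure d d' (T1 : measurableType d) (T2 : measurableType d')
  (R : realType) (m : {measure set T1 -> \bar R}) (phi : T1 -> T2)
  (mphi : measurable_fun setT phi) : {measure set T2 -> \bar R} :=
  measure_function_pushforward__canonical__measure_function_Measure m mphi.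

Section lebesgue_measure_1d.
Context (R : realType).
Notation mu := (@lebesgue_measure R).

Lemma measurable_affine (a b : R) :
  measurable_fun [set: measurableTypeR R]
    ((fun x => (a * x + b)%R) : _ -> measurableTypeR R).
Proof. by apply: measurable_funD => //; exact: measurable_funM. Qed.

Lemma measurable_opp : measurable_fun [set: measurableTypeR R]
  (-%R : _ -> measurableTypeR R).
Proof. exact: measurable_funN. Qed.

(** Both sides agree on half-open intervals, hence everywhere. *)
Lemma lebesgue_measure_affine (a b : R) (a0 : 0 < a) A : measurable A ->
  mu A = mscale (NngNum (ltW a0)) (image_measure mu (measurable_affine a b)) A.
Proof.
move=> mA; apply: lebesgue_measure_unique => //= _ [[u v]] _ <-.
rewrite /mscale /= /image_measure /pushforward /=.
rewrite (_ : _ @^-1` _ = `](u - b) / a, (v - b) / a]%classic); last first.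
  apply/seteqP; split => x /=; rewrite !in_itv /= ltr_pdivrMr// ler_pdivlMr//;
  by rewrite ltrBlDr lerBrDr mulrC.
rewrite !lebesgue_measure_itv/= !lte_fin ltr_pM2r ?invr_gt0// ltrD2r.
case: ifPn => _; last by rewrite mule0.
rewrite -!EFinB -EFinM; congr EFin; field; exact: lt0r_neq0.
Qed.

Lemma ge0_integral_affine (a b : R) (f : R -> \bar R) : 0 < a ->
  measurable_fun setT f -> (forall x, (0 <= f x)%E) ->
  (\int[mu]_x f x = a%:E * \int[mu]_x f (a * x + b)%R)%E.
Proof.
move=> a0 mf f0; rewrite (eq_measure_integral
  (mscale (NngNum (ltW a0)) (image_measure mu (measurable_affine a b)))).
  rewrite ge0_integral_mscale//=; congr (_ * _)%E.
  by rewrite (ge0_integral_pushforward (measurable_affine a b)).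
by move=> A mA _; exact: lebesgue_measure_affine.
Qed.

Lemma ge0_integral_shift (b : R) (f : R -> \bar R) :
  measurable_fun setT f -> (forall x, (0 <= f x)%E) ->
  (\int[mu]_x f (x + b)%R = \int[mu]_x f x)%E.
Proof.
move=> mf f0; rewrite [RHS](ge0_integral_affine b ltr01)// mul1e.
by under [RHS]eq_integral do rewrite mul1r.
Qed.

Lemma ge0_integral_opp (f : R -> \bar R) :
  measurable_fun setT f -> (forall x, (0 <= f x)%E) ->
  (\int[mu]_x f (- x)%R = \int[mu]_x f x)%E.
Proof.
move=> mf f0; rewrite [RHS](eq_measure_integral (image_measure mu measurable_opp)).
  by rewrite (ge0_integral_pushforward measurable_opp).
by move=> A mA _; exact: (esym (lebesgue_measureN mA)).
Qed.

End lebesgue_measure_1d.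

Section invariance_parts.
Context d (T : measurableType d) (R : realType) (mu : {measure set T -> \bar R}).
Variables (phi : T -> T) (c : R).
Hypothesis mphi : measurable_fun setT phi.
Hypothesis hphi : forall f : T -> \bar R,
  measurable_fun setT f -> (forall x, (0 <= f x)%E) ->
  (\int[mu]_x f x = c%:E * \int[mu]_x f (phi x))%E.

(** A change of variables known for nonnegative functions passes to integrable
    ones through their positive and negative parts. *)
Lemma L1_substitution f : L1 mu f -> 0 < c -> L1 mu (fun x => f (phi x)).
Proof.
move=> f1 cp; have mf := L1_measurable f1.
apply: L1_fin; first exact: measurableT_comp.
have /integrableP[_] := f1.
rewrite (hphi (f := (fun x => `|(f x)%:E|)%E))//.
  by move=> h; rewrite ltey; apply: contraTneq h => /= ->; rewrite gt0_muley// lte_fin.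
by apply: measurableT_comp => //; exact/measurable_EFinP.
Qed.

Lemma Rintegral_substitution f : L1 mu f -> 0 < c ->
  \int[mu]_x f x = c * \int[mu]_x f (phi x).
Proof.
move=> f1 cp; have mf := L1_measurable f1.
have fp := L1_substitution f1 cp.
apply: EFin_inj; rewrite EFinM !EFin_Rintegral//.
have mE : measurable_fun setT (EFin \o f) by exact/measurable_EFinP.
rewrite integralE (hphi (measurable_funepos mE))//.
rewrite (hphi (measurable_funeneg mE))//.
rewrite [in RHS]integralE -muleBr//; last first.
  apply: fin_num_adde_defl.
  have := integrable_fin_num measurableT (integrable_funeneg measurableT fp).
  rewrite fin_numN; congr (_ \is a fin_num); apply: eq_integral => x _.
  by rewrite !funenegE.
by congr (_ * (_ - _))%E; apply: eq_integral => x _; rewrite !(funeposE,funenegE).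
Qed.

End invariance_parts.

(** * Lebesgue integration over row vectors, one coordinate at a time *)

Section lebesgue_rV_integral.
Context (R : realType).
Notation mu := (@lebesgue_measure R).
Notation lam := (@lebesgue_rV R).

(** The line carries here the sigma-algebra on which [lebesgue_measure] is
    declared, so that the product measure can be transported. *)
Lemma measurable_cons_rV_lebesgue n :
  measurable_fun [set: (measurableTypeR R * 'rV[R]_n)%type]
    (@cons_rV R n : measurableTypeR R * 'rV[R]_n -> 'rV[R]_n.+1).
Proof. exact: measurable_cons_rV. Qed.

Lemma ge0_integral_rVS n (f : 'rV[R]_n.+1 -> \bar R) : measurable_fun setT f ->
  (forall x, (0 <= f x)%E) ->
  (\int[lam n.+1]_x f x = \int[(mu \x lam n)%E]_p f (cons_rV p))%E.
Proof.
move=> mf f0.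
rewrite (eq_measure_integral (image_measure (mu \x lam n)%E (@measurable_cons_rV_lebesgue n)))//.
by rewrite (ge0_integral_pushforward (@measurable_cons_rV_lebesgue n)).
Qed.

Lemma ge0_integral_rVS12 n (f : 'rV[R]_n.+1 -> \bar R) : measurable_fun setT f ->
  (forall x, (0 <= f x)%E) ->
  (\int[lam n.+1]_x f x = \int[mu]_a \int[lam n]_v f (cons_rV (a, v)))%E.
Proof.
move=> mf f0; rewrite ge0_integral_rVS//.
apply: (fubini_tonelli1 (m1 := mu) (m2 := lam n) (fun p => f (cons_rV p))) => //.
exact: (measurableT_comp mf (@measurable_cons_rV R n)).
Qed.

Lemma ge0_integral_rVS21 n (f : 'rV[R]_n.+1 -> \bar R) : measurable_fun setT f ->
  (forall x, (0 <= f x)%E) ->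
  (\int[lam n.+1]_x f x = \int[lam n]_v \int[mu]_a f (cons_rV (a, v)))%E.
Proof.
move=> mf f0; rewrite ge0_integral_rVS//.
apply: (fubini_tonelli2 (m1 := mu) (m2 := lam n) (fun p => f (cons_rV p))) => //.
exact: (measurableT_comp mf (@measurable_cons_rV R n)).
Qed.

Lemma L1_rVS n (f : 'rV[R]_n.+1 -> R) : L1 (lam n.+1) f ->
  L1 (mu \x lam n)%E (fun p => f (cons_rV p)).
Proof.
move=> f1; have mf := L1_measurable f1.
apply: L1_fin; first exact: (measurableT_comp mf (@measurable_cons_rV R n)).
have /integrableP[_] := f1.
rewrite (ge0_integral_rVS (f := fun x => `|(f x)%:E|%E))//.
by apply: measurableT_comp => //; exact/measurable_EFinP.
Qed.

Lemma Rintegral_rVS n (f : 'rV[R]_n.+1 -> R) : measurable_fun setT f ->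
  \int[lam n.+1]_x f x = \int[(mu \x lam n)%E]_p f (cons_rV p).
Proof.
move=> mf; congr fine.
have mE : measurable_fun setT (EFin \o f) by exact/measurable_EFinP.
rewrite integralE (ge0_integral_rVS (measurable_funepos mE))//.
rewrite (ge0_integral_rVS (measurable_funeneg mE))//.
rewrite [in RHS]integralE.
by congr (_ - _)%E; apply: eq_integral => x _; rewrite !(funeposE,funenegE).
Qed.

Lemma measurable_shift_rV n (s : 'rV[R]_n) :
  measurable_fun setT (fun x : 'rV[R]_n => x + s).
Proof.
apply/measurable_fun_rVP => i.
under eq_fun do rewrite mxE.
by apply: measurable_funD => //; exact: measurable_coord_rV.
Qed.

Lemma cons_rVD n (a b : R) (v w : 'rV[R]_n) :
  cons_rV (a, v) + cons_rV (b, w) = cons_rV (a + b, v + w).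
Proof.
apply/rowP => i; case: (unliftP ord0 i) => [j ->|->].
  by rewrite mxE !cons_rV_lift mxE.
by rewrite mxE !cons_rV0.
Qed.

Lemma uncons_rVK n : cancel (@uncons_rV R n) (@cons_rV R n).
Proof.
move=> v; apply/rowP => i; case: (unliftP ord0 i) => [j ->|->].
  rewrite cons_rV_lift /= mxE; congr (v _ _); exact: val_inj.
by rewrite cons_rV0.
Qed.

(** By induction on the dimension: each coordinate is translated in turn under
    Tonelli's iterated integral. *)
Lemma ge0_integral_rV_shift n (s : 'rV[R]_n) (f : 'rV[R]_n -> \bar R) :
  measurable_fun setT f -> (forall x, (0 <= f x)%E) ->
  (\int[lam n]_x f (x + s)%R = \int[lam n]_x f x)%E.
Proof.
elim: n s f => [|n IH] s f mf f0.
  by apply: eq_integral => x _; congr f; apply/rowP; case.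
have mfs : measurable_fun setT (fun x : 'rV[R]_n.+1 => f (x + s)%R).
  exact: (measurableT_comp mf (measurable_shift_rV s)).
rewrite (ge0_integral_rVS12 mfs); last by [].
rewrite [RHS](ge0_integral_rVS12 mf f0).
rewrite -(uncons_rVK s); case: (uncons_rV s) => b w.
transitivity (\int[mu]_a \int[lam n]_v f (cons_rV ((a + b)%R, v)))%E.
  apply: eq_integral => a _.
  rewrite -(IH w (fun v => f (cons_rV ((a + b)%R, v))))//.
    by apply: eq_integral => v _; rewrite cons_rVD.
  apply: (measurableT_comp mf); apply: (measurableT_comp (@measurable_cons_rV R n)).
  exact: measurable_fun_pair.
apply: (ge0_integral_shift b (f := fun a => \int[lam n]_v f (cons_rV (a, v)))%E).
  apply: (measurable_fun_fubini_tonelli_F (m2 := lam n) (fun p => f (cons_rV p))) => //.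
  exact: (measurableT_comp mf (@measurable_cons_rV R n)).
by move=> a; exact: integral_ge0.
Qed.

End lebesgue_rV_integral.

Section dominated.
Context d (T : measurableType d) (R : realType) (mu : {measure set T -> \bar R}).

Lemma Rintegral_cvg (fn : nat -> T -> R) (f g : T -> R) :
  (forall n, measurable_fun setT (fn n)) -> measurable_fun setT f ->
  {ae mu, forall x, (fn ^~ x) @ \oo --> f x} ->
  L1 mu g -> (forall n x, `|fn n x| <= g x) ->
  (\int[mu]_x fn n x) @[n --> \oo] --> \int[mu]_x f x.
Proof.
move=> mfn mf fnf g1 fng.
have [| | |//| |f1 _] := @dominated_convergence _ _ _ mu setT measurableT
  (fun n x => (fn n x)%:E) (fun x => (f x)%:E) (fun x => (g x)%:E).
- by move=> n; exact/measurable_EFinP.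
- exact/measurable_EFinP.
- by apply: filterS fnf => x fx _; apply: cvg_EFin => //; exact: nearW.
- by apply: nearW => x n _; rewrite lee_fin.
move=> H; apply: fine_cvg; rewrite fineK//; exact: integrable_fin_num.
Qed.

End dominated.

(** * The Abel weight and the Poisson kernel *)

Section kernels.
Context (R : realType).
Notation mu := (@lebesgue_measure R).
Implicit Types a b t x : R.

Lemma is_derive_linear a x : is_derive x 1 (fun y => a * y) a.
Proof.
have := @is_deriveZ R R R id a x 1 1 _; rewrite /GRing.scale /= mulr1; exact.
Qed.

Lemma is_derive_exp_linear a x :
  is_derive x 1 (fun y => expR (a * y)) (expR (a * x) * a).
Proof. exact: is_derive1_comp (is_derive_expR _) (is_derive_linear a x). Qed.

Lemma is_derive_cos_linear a x :
  is_derive x 1 (fun y => cos (a * y)) (- sin (a * x) * a).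
Proof. exact: is_derive1_comp (is_derive_cos _) (is_derive_linear a x). Qed.

Lemma is_derive_sin_linear a x :
  is_derive x 1 (fun y => sin (a * y)) (cos (a * x) * a).
Proof. exact: is_derive1_comp (is_derive_sin _) (is_derive_linear a x). Qed.

Lemma continuous_linear a : continuous (fun x : R => a * x).
Proof. by move=> x; apply: cvgM; [exact: cvg_cst|exact: cvg_id]. Qed.

Lemma continuous_cos_linear a : continuous (fun x : R => cos (a * x)).
Proof. by move=> x; apply: continuous_comp; [exact: continuous_linear|exact: continuous_cos]. Qed.

Lemma continuous_expabs a : continuous (fun x : R => expR (- a * `|x|)).
Proof.
move=> x; apply: (@continuous_comp _ _ _ (fun y => - a * `|y|) expR); last exact: continuous_expR.
by apply: cvgM; [exact: cvg_cst|exact: norm_continuous].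
Qed.

Lemma cvgy_exp_bounded a (M : R) (h : R -> R) : 0 < a -> (forall x, `|h x| <= M) ->
  expR (- a * x) * h x @[x --> +oo] --> 0.
Proof.
move=> a0 hM.
have e0 : expR (- a * x) * M @[x --> +oo] --> 0.
  rewrite -(mul0r M); apply: cvgM; last exact: cvg_cst.
  under eq_fun do rewrite mulNr.
  apply: (cvg_comp (fun x => a * x) (fun x => expR (- x)) _ (@cvgr_expR R)).
  by apply: gt0_cvgMry => //; exact: cvg_id.
apply/cvgr0Pnorm_le => e e_gt0.
move/cvgr0_norm_le : e0 => /(_ e e_gt0); apply: filterS => x.
apply: le_trans; by rewrite !normrM ler_wpM2l// (le_trans (hM x))// ler_norm.
Qed.

(** The integrand is made nonnegative by adding 1 to the cosine, because the
    convergence of a primitive at infinity then also gives integrability; the case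
    [b = 0] isolates the two terms. *)
Lemma integral_exp_cos1 a b : 0 < a ->
  (\int[mu]_x (expR (- a * `|x|) * (1 + cos (b * x)))%:E =
    (2 / a + 2 * a / (a ^+ 2 + b ^+ 2))%:E)%E.
Proof.
move=> a0.
have ab0 : a ^+ 2 + b ^+ 2 != 0 by rewrite lt0r_neq0// ltr_pwDl ?exprn_gt0 ?sqr_ge0.
have p0 x : 0 <= 1 + cos (b * x) by rewrite -(subrr 1) lerD2l cos_geN1.
have cc : continuous (fun x => 1 + cos (b * x)).
  by move=> x; apply: cvgD; [exact: cvg_cst|exact: continuous_cos_linear].
rewrite ge0_symfun_integralT//; last 2 first.
- by move=> x; apply: cvgM; [exact: continuous_expabs|exact: cc].
- by move=> x /=; rewrite normrN mulrN cosN.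
pose F x := expR (- a * x) * (- a^-1 + (b * sin (b * x) - a * cos (b * x)) / (a ^+ 2 + b ^+ 2)).
pose g x := expR (- a * x) * (1 + cos (b * x)).
have dF x : is_derive x 1 F (g x).
  pose G x := - a^-1 + (b * sin (b * x) - a * cos (b * x)) / (a ^+ 2 + b ^+ 2).
  have dG : is_derive x 1 G
      (b * (cos (b * x) * b) / (a ^+ 2 + b ^+ 2) - a * (- sin (b * x) * b) / (a ^+ 2 + b ^+ 2)).
    pose k1 := b / (a ^+ 2 + b ^+ 2); pose k2 := a / (a ^+ 2 + b ^+ 2).
    have D := is_deriveD (is_derive_cst (- a^-1 : R) (x : R) 1)
      (is_deriveB (@is_deriveZ _ _ _ _ k1 x 1 _ (is_derive_sin_linear b x))
                  (@is_deriveZ _ _ _ _ k2 x 1 _ (is_derive_cos_linear b x))).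
    rewrite [G](_ : _ = cst (- a^-1) + (k1 \*: (fun y : R => sin (b * y)) -
      k2 \*: (fun y : R => cos (b * y)))); last first.
      apply/funext => y; change (G y = - a^-1 + (k1 * sin (b * y) - k2 * cos (b * y))).
      rewrite /G /k1 /k2; move: (cos _) (sin _) => u v; field.
      by rewrite ab0 lt0r_neq0.
    apply: (is_derive_eq D); rewrite /GRing.scale /= /k1 /k2.
    by move: (cos _) (sin _) => u v; field.
  have dE := is_derive_exp_linear (- a) x.
  have := is_deriveM dE dG.
  move=> H; apply: (is_derive_eq H).
  rewrite /GRing.scale /= /g /G; field; rewrite ab0 lt0r_neq0//.
rewrite (_ : [set x | 0 <= x] = `[0, +oo[%classic); last first.
  by apply/seteqP; split => x /=; rewrite in_itv /= andbT.
transitivity (2%:E * \int[mu]_(x in `[0%R, +oo[) (g x)%:E)%E.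
  congr (_ * _)%E; apply: eq_integral => x.
  by rewrite inE /= in_itv /= andbT => x0; rewrite /g ger0_norm.
rewrite (ge0_continuous_FTC2y (F := F) (l := 0)).
- rewrite /F !mulr0 expR0 cos0 sin0 -EFinB -EFinM; congr EFin; field.
  by rewrite ab0 lt0r_neq0.
- by move=> x _; rewrite mulr_ge0// expR_ge0.
- apply: continuous_subspaceT => x; apply: cvgM; last exact: cc.
  apply: (@continuous_comp _ _ _ (fun y => - a * y) expR); last exact: continuous_expR.
  exact: continuous_linear.
- apply: (@cvgy_exp_bounded _ (a^-1 + (`|b| + `|a|) / (a ^+ 2 + b ^+ 2))) => // x.
  have ab1 : 0 <= a ^+ 2 + b ^+ 2 by rewrite addr_ge0 ?sqr_ge0.
  rewrite (le_trans (ler_normD _ _))// normrN ger0_norm ?invr_ge0 ?(ltW a0)// lerD2l.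
  rewrite normrM [X in _ * X]ger0_norm ?invr_ge0// ler_wpM2r ?invr_ge0//.
  rewrite (le_trans (ler_normB _ _))// lerD// normrM ler_piMr//.
    by rewrite ler_norml sin_geN1 sin_le1.
  by rewrite ler_norml cos_geN1 cos_le1.
- by move=> x _; exact: ex_derive.
- apply: cvg_at_right_filter.
  by apply: differentiable_continuous; apply/derivable1_diffP; exact: ex_derive.
- by move=> x _; rewrite derive1E; exact: derive_val.
Qed.

Lemma measurable_cos_linear b : measurable_fun setT (fun x : R => cos (b * x)).
Proof. apply: continuous_measurable_fun; exact: continuous_cos_linear. Qed.

Lemma L1_expabs a : 0 < a -> L1 mu (fun x => expR (- a * `|x|)).
Proof.
move=> a0.
have mE : measurable_fun setT (fun x => expR (- a * `|x|)).
  apply: continuous_measurable_fun; exact: continuous_expabs.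
apply: L1_fin => //.
apply: (@le_lt_trans _ _ (\int[mu]_x (expR (- a * `|x|) * (1 + cos (0 * x)))%:E)%E).
  apply: ge0_le_integral => //.
  - by apply/measurable_EFinP; exact: measurableT_comp.
  - apply/measurable_EFinP/measurable_funM => //.
    by apply: measurable_funD => //; exact: measurable_cos_linear.
  - move=> x _; rewrite lee_fin ger0_norm ?expR_ge0// ler_peMr ?expR_ge0//.
    by rewrite mul0r cos0 lerDl.
by rewrite integral_exp_cos1// ltry.
Qed.

(** With [a = 2 pi eps] and [b = 2 pi s] the right-hand side is the Poisson
    kernel of the line, of total mass 1. *)
Lemma Rintegral_exp_cos a b : 0 < a ->
  \int[mu]_x (expR (- a * `|x|) * cos (b * x)) = 2 * a / (a ^+ 2 + b ^+ 2).
Proof.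
move=> a0; have E1 := L1_expabs a0.
have EC c : L1 mu (fun x => expR (- a * `|x|) * cos (c * x)).
  apply: (L1_bounded (M := 1)) => //; first exact: measurable_cos_linear.
  by move=> x; rewrite ler_norml cos_geN1 cos_le1.
have H c : \int[mu]_x expR (- a * `|x|) + \int[mu]_x (expR (- a * `|x|) * cos (c * x))
   = 2 / a + 2 * a / (a ^+ 2 + c ^+ 2).
  rewrite -Rintegral_add//.
  under eq_Rintegral => x _ do rewrite -[X in X + _]mulr1 -mulrDr.
  by rewrite /Rintegral integral_exp_cos1.
have := H b; have := H 0.
under [X in _ + X]eq_Rintegral do rewrite mul0r cos0 mulr1.
rewrite (_ : 2 / a + 2 * a / (a ^+ 2 + 0 ^+ 2) = 2 * (2 / a)); last first.
  by field; exact: lt0r_neq0.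
have aux (I J u v : R) : I + I = 2 * u -> I + J = u + v -> J = v by move=> *; lra.
exact: aux.
Qed.

Lemma continuous_poisson : continuous (fun u : R => (1 + u ^+ 2)^-1).
Proof.
move=> u; apply: cvgV; first by rewrite lt0r_neq0// ltr_pwDl ?sqr_ge0.
by apply: cvgD; [exact: cvg_cst|exact: exprn_continuous].
Qed.

Lemma integral_poisson : (\int[mu]_u ((1 + u ^+ 2)^-1)%:E = (pi : R)%:E)%E.
Proof.
have p0 (u : R) : 0 < 1 + u ^+ 2 by rewrite ltr_pwDl ?sqr_ge0.
rewrite ge0_symfun_integralT; last 3 first.
- by move=> u; rewrite invr_ge0 ltW.
- exact: continuous_poisson.
- by move=> u /=; rewrite sqrrN.
rewrite (_ : [set x | 0 <= x] = `[0, +oo[%classic); last first.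
  by apply/seteqP; split => x /=; rewrite in_itv /= andbT.
rewrite (ge0_continuous_FTC2y (F := atan) (l := pi / 2)).
- by rewrite atan0 sube0 -EFinM mulrC divfK.
- by move=> u _; rewrite invr_ge0 ltW.
- exact: continuous_subspaceT continuous_poisson.
- exact: cvgy_atan.
- by move=> x _; exact: derivable_atan.
- by apply: cvg_at_right_filter; exact: continuous_atan.
- by move=> x _; rewrite derive1_atan.
Qed.

Lemma L1_poisson : L1 mu (fun u : R => (1 + u ^+ 2)^-1).
Proof.
apply: L1_fin; first by apply: continuous_measurable_fun; exact: continuous_poisson.
under eq_integral => u _.
  rewrite ger0_norm; last by rewrite invr_ge0 addr_ge0 ?sqr_ge0.
  over.
by rewrite integral_poisson ltry.
Qed.

Lemma Rintegral_poisson : \int[mu]_u (1 + u ^+ 2)^-1 = pi :> R.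
Proof. by rewrite /Rintegral integral_poisson. Qed.

End kernels.

(** * Plancherel's inequality for bounded continuous functions on the line *)

Section fourier_real_line.
Context (R : realType).
Notation mu := (@lebesgue_measure R).
Implicit Types (f g : R -> R) (x y t : R).

(** The Fourier transform of a real function is [cosT f + i sinT f]. *)
Definition cosT f t := \int[mu]_x (f x * cos (2 * pi * (x * t))).
Definition sinT f t := \int[mu]_x (f x * sin (2 * pi * (x * t))).

Lemma norm_cos_le1 x : `|cos x| <= 1.
Proof. by rewrite ler_norml cos_geN1 cos_le1. Qed.

Lemma norm_sin_le1 x : `|sin x| <= 1.
Proof. by rewrite ler_norml sin_geN1 sin_le1. Qed.

Lemma measurable_cos_comp d (T : measurableType d) (u : T -> R) :
  measurable_fun setT u -> measurable_fun setT (fun z => cos (u z)).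
Proof.
by move=> mu_; apply: measurableT_comp => //; apply: continuous_measurable_fun;
  exact: continuous_cos.
Qed.

Lemma measurable_sin_comp d (T : measurableType d) (u : T -> R) :
  measurable_fun setT u -> measurable_fun setT (fun z => sin (u z)).
Proof.
by move=> mu_; apply: measurableT_comp => //; apply: continuous_measurable_fun;
  exact: continuous_sin.
Qed.

Lemma measurable_phase : measurable_fun setT (fun z : R * R => 2 * pi * (z.2 * z.1)).
Proof. by apply: measurable_funM => //; apply: measurable_funM. Qed.

Lemma measurable_phase1 t : measurable_fun setT (fun x : R => 2 * pi * (x * t)).
Proof. by apply: measurable_funM => //; apply: measurable_funM. Qed.

Lemma measurable_cosT f : measurable_fun setT f -> measurable_fun setT (cosT f).
Proof.
move=> mf; apply: (measurable_Rintegral_param mu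
  (h := fun z : R * R => f z.2 * cos (2 * pi * (z.2 * z.1)))).
apply: measurable_funM; first exact: measurableT_comp.
by apply: measurable_cos_comp; exact: measurable_phase.
Qed.

Lemma measurable_sinT f : measurable_fun setT f -> measurable_fun setT (sinT f).
Proof.
move=> mf; apply: (measurable_Rintegral_param mu
  (h := fun z : R * R => f z.2 * sin (2 * pi * (z.2 * z.1)))).
apply: measurable_funM; first exact: measurableT_comp.
by apply: measurable_sin_comp; exact: measurable_phase.
Qed.

Lemma L1_cos f t : L1 mu f -> L1 mu (fun x => f x * cos (2 * pi * (x * t))).
Proof.
move=> f1; apply: (L1_bounded (M := 1)) => //.
  by apply: measurable_cos_comp; exact: measurable_phase1.
by move=> x; exact: norm_cos_le1.
Qed.

Lemma L1_sin f t : L1 mu f -> L1 mu (fun x => f x * sin (2 * pi * (x * t))).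
Proof.
move=> f1; apply: (L1_bounded (M := 1)) => //.
  by apply: measurable_sin_comp; exact: measurable_phase1.
by move=> x; exact: norm_sin_le1.
Qed.

Lemma norm_Rintegral_le f g : L1 mu f -> L1 mu g -> (forall x, `|f x| <= g x) ->
  `|\int[mu]_x f x| <= \int[mu]_x g x.
Proof.
move=> f1 g1 fg; apply: (le_trans (le_normr_Rintegral _ f1)) => //.
by apply: le_Rintegral => //; exact: L1_norm.
Qed.

Lemma cosT_le f t : L1 mu f -> `|cosT f t| <= \int[mu]_x `|f x|.
Proof.
move=> f1; apply: norm_Rintegral_le; [exact: L1_cos|exact: L1_norm|move=> x].
by rewrite normrM ler_piMr// norm_cos_le1.
Qed.

Lemma sinT_le f t : L1 mu f -> `|sinT f t| <= \int[mu]_x `|f x|.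
Proof.
move=> f1; apply: norm_Rintegral_le; [exact: L1_sin|exact: L1_norm|move=> x].
by rewrite normrM ler_piMr// norm_sin_le1.
Qed.

(** Integrating this identity against [f] again expresses |f^|^2 as the double
    integral of f(x) f(y) cos (2 pi (x - y) t). *)
Lemma Rintegral_cos_diff f x t : L1 mu f ->
  \int[mu]_y (f y * cos (2 * pi * ((x - y) * t))) =
  cos (2 * pi * (x * t)) * cosT f t + sin (2 * pi * (x * t)) * sinT f t.
Proof.
move=> f1; rewrite -!Rintegral_scale; [|exact: L1_sin|exact: L1_cos].
rewrite -Rintegral_add; last 2 first.
  exact/L1Z/L1_cos.
  exact/L1Z/L1_sin.
apply: eq_Rintegral => y _.
by rewrite mulrBl mulrBr cosB; ring.
Qed.

Let poisson_kernelE (p e z : R) : 0 < p -> 0 < e ->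
  2 * (2 * p * e) / ((2 * p * e) ^+ 2 + (2 * p * z) ^+ 2) =
  p^-1 * (e / (e ^+ 2 + z ^+ 2)).
Proof.
move=> p0 e0; have ep : 0 < e ^+ 2 + z ^+ 2 by rewrite ltr_pwDl ?exprn_gt0 ?sqr_ge0.
rewrite (_ : _ ^+ 2 + _ = (2 * p) ^+ 2 * (e ^+ 2 + z ^+ 2)); last by ring.
by field; rewrite (lt0r_neq0 ep) lt0r_neq0.
Qed.

Let poisson_kernel_scaled (p e u x G : R) : 0 < p -> 0 < e ->
  e * (G * (p^-1 * (e / (e ^+ 2 + (x - (e * u + x)) ^+ 2)))) =
  p^-1 * (G * (1 + u ^+ 2)^-1).
Proof.
move=> p0 e0; have up : 0 < 1 + u ^+ 2 by rewrite ltr_pwDl ?sqr_ge0.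
rewrite (_ : _ ^+ 2 + _ = e ^+ 2 * (1 + u ^+ 2)); last by ring.
by field; rewrite (lt0r_neq0 up) (lt0r_neq0 e0) lt0r_neq0.
Qed.

Section bounded_continuous.
Variables (g : R -> R) (M : R).
Hypothesis g1 : L1 mu g.
Hypothesis gM : forall x, `|g x| <= M.
Hypothesis cg : continuous g.

Let mg : measurable_fun setT g. Proof. exact: L1_measurable g1. Qed.
Let N := \int[mu]_x `|g x|.
Let w e t := expR (- (2 * pi * e) * `|t|).
Let k x t := cos (2 * pi * (x * t)) * cosT g t + sin (2 * pi * (x * t)) * sinT g t.

Let M0 : 0 <= M. Proof. exact: le_trans (gM 0). Qed.

Let poisson e x := pi^-1 * \int[mu]_u (g (e * u + x) * (1 + u ^+ 2)^-1).

Let w1 e : 0 < e -> L1 mu (w e).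
Proof. by move=> e0; apply: L1_expabs; rewrite !mulr_gt0// pi_gt0. Qed.

Let k_le x t : `|k x t| <= N + N.
Proof.
rewrite (le_trans (ler_normD _ _))// lerD// normrM.
  by rewrite (le_trans _ (cosT_le t g1))// ler_piMl// norm_cos_le1.
by rewrite (le_trans _ (sinT_le t g1))// ler_piMl// norm_sin_le1.
Qed.

Let mk : measurable_fun setT (fun z : R * R => k z.2 z.1).
Proof.
apply: measurable_funD; apply: measurable_funM.
- by apply: measurable_cos_comp; exact: measurable_phase.
- by apply: measurableT_comp measurable_fst; exact: measurable_cosT.
- by apply: measurable_sin_comp; exact: measurable_phase.
- by apply: measurableT_comp measurable_fst; exact: measurable_sinT.
Qed.

(* The integral over [x] of g(x) k(x, t) is |g^(t)|^2. *)
Let abel_energy e : 0 < e ->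
  \int[mu]_t (w e t * (cosT g t ^+ 2 + sinT g t ^+ 2)) =
  \int[mu]_t \int[mu]_x (w e t * g x * k x t).
Proof.
move=> e0; apply: eq_Rintegral => t _.
under [RHS]eq_Rintegral => x _.
  rewrite (_ : _ * _ * _ = w e t * cosT g t * (g x * cos (2 * pi * (x * t))) +
     w e t * sinT g t * (g x * sin (2 * pi * (x * t)))); last by rewrite /k; ring.
  over.
rewrite Rintegral_add; [|exact/L1Z/L1_cos|exact/L1Z/L1_sin].
rewrite !Rintegral_scale; [|exact: L1_sin|exact: L1_cos].
rewrite -/(cosT g t) -/(sinT g t); ring.
Qed.

Let swap1 e : 0 < e ->
  \int[mu]_t \int[mu]_x (w e t * g x * k x t) =
  \int[mu]_x \int[mu]_t (w e t * g x * k x t).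
Proof.
move=> e0; apply: (Rintegral_swap (m1 := mu) (m2 := mu)
  (h := fun z : R * R => w e z.1 * g z.2 * k z.2 z.1)).
apply: (L1_prod (M := N + N) (w1 e0) g1).
  apply: measurable_funM; last exact: mk.
  apply: measurable_funM; last exact: measurableT_comp.
  by apply: measurableT_comp measurable_fst; exact: L1_measurable (w1 e0).
move=> t x; change (`|w e t * g x * k x t| <= (N + N) * `|w e t| * `|g x|).
by rewrite !normrM -[leRHS]mulrA [leRHS]mulrC ler_wpM2l ?mulr_ge0.
Qed.

Let kernelE e x : 0 < e ->
  \int[mu]_t (w e t * k x t) = poisson e x.
Proof.
move=> e0.
have a0 : 0 < 2 * pi * e :> R by rewrite !mulr_gt0// pi_gt0.
transitivity (\int[mu]_t \int[mu]_y (w e t * g y * cos (2 * pi * ((x - y) * t)))).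
  apply: eq_Rintegral => t _.
  rewrite /k -Rintegral_cos_diff// -Rintegral_scale.
    by apply: eq_Rintegral => y _; rewrite mulrA.
  apply: (L1_bounded (M := 1)) => //; last by move=> y; exact: norm_cos_le1.
  apply: measurable_cos_comp; apply: measurable_funM => //; apply: measurable_funM => //.
  exact: measurable_funB.
rewrite (Rintegral_swap (m1 := mu) (m2 := mu)
  (h := fun z : R * R => w e z.1 * g z.2 * cos (2 * pi * ((x - z.2) * z.1)))); last first.
  apply: (L1_prod (M := 1) (w1 e0) g1).
    apply: measurable_funM.
      apply: measurable_funM; last exact: measurableT_comp.
      by apply: measurableT_comp measurable_fst; exact: L1_measurable (w1 e0).
    apply: measurable_cos_comp; apply: measurable_funM => //; apply: measurable_funM => //.
    exact: measurable_funB.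
  move=> t y; change (`|w e t * g y * cos (2 * pi * ((x - y) * t))| <= 1 * `|w e t| * `|g y|).
  by rewrite mul1r !normrM ler_piMr ?mulr_ge0// norm_cos_le1.
(* The integrand of the Poisson average, before the scaling [y = e * u + x]. *)
pose q y := g y * (pi^-1 * (e / (e ^+ 2 + (x - y) ^+ 2))).
have qE y : \int[mu]_t (w e t * g y * cos (2 * pi * ((x - y) * t))) = q y.
  under eq_Rintegral => t _.
    rewrite (_ : _ * _ = g y * (w e t * cos (2 * pi * (x - y) * t))); last first.
      by rewrite !mulrA; ring.
    over.
  rewrite Rintegral_scale; last first.
    apply: (L1_bounded (M := 1) (w1 e0)); first exact: measurable_cos_linear.
    by move=> t; exact: norm_cos_le1.
  by rewrite Rintegral_exp_cos// /q poisson_kernelE// pi_gt0.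
rewrite (eq_Rintegral _ (fun _ _ => qE _)).
have mq : measurable_fun setT q.
  apply: measurable_funM => //; apply: measurable_funM => //; apply: measurable_funM => //.
  apply: continuous_measurable_fun => y; apply: cvgV.
    by rewrite lt0r_neq0// ltr_pwDl ?exprn_gt0 ?sqr_ge0.
  apply: cvgD; first exact: cvg_cst.
  apply: (@continuous_comp _ _ _ (fun y => x - y) (fun y => y ^+ 2)); last exact: exprn_continuous.
  by apply: cvgB; [exact: cvg_cst|exact: cvg_id].
have q1 : L1 mu q.
  apply: (L1_le (mu := mu) (g := fun y => (pi^-1 * e^-1) * `|g y|)) => //; last exact/L1Z/L1_norm.
  move=> y; rewrite /q normrM mulrC ler_wpM2r// normrM ger0_norm ?invr_ge0 ?pi_ge0//.
  rewrite ler_wpM2l ?invr_ge0 ?pi_ge0//.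
  have ep : 0 < e ^+ 2 + (x - y) ^+ 2 by rewrite ltr_pwDl ?exprn_gt0 ?sqr_ge0.
  rewrite ger0_norm; last by rewrite divr_ge0// ltW.
  rewrite ler_pdivrMr// mulrDr expr2 mulrA mulVf ?lt0r_neq0// mul1r lerDl.
  by rewrite mulr_ge0 ?sqr_ge0// invr_ge0 ltW.
rewrite (Rintegral_substitution (measurable_affine e x)
  (fun h mh h0 => ge0_integral_affine x e0 mh h0) q1 e0).
rewrite /poisson -!Rintegral_scale.
- by apply: eq_Rintegral => u _; rewrite /q poisson_kernel_scaled// pi_gt0.
- rewrite (_ : (fun _ => _) = (fun u => ((1 + u ^+ 2)^-1 * g (e * u + x))%:E)); last first.
    by apply/funext => u; rewrite mulrC.
  apply: (L1_bounded (M := M) (L1_poisson R)) => //.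
  exact: (measurableT_comp mg (measurable_affine e x)).
- exact: (L1_substitution (measurable_affine e x) 
  (fun h mh h0 => ge0_integral_affine x e0 mh h0) q1 e0).
Qed.

Let shifted_le e x u : `|g (e * u + x) * (1 + u ^+ 2)^-1| <= M * (1 + u ^+ 2)^-1.
Proof.
have p0 : 0 <= (1 + u ^+ 2)^-1 by rewrite invr_ge0 addr_ge0 ?sqr_ge0.
by rewrite normrM [X in _ * X]ger0_norm// ler_wpM2r.
Qed.

Let L1_shifted e x : L1 mu (fun u => g (e * u + x) * (1 + u ^+ 2)^-1).
Proof.
apply: (L1_le (mu := mu) (g := fun u => M * (1 + u ^+ 2)^-1)) => //; last exact/L1Z/L1_poisson.
apply: measurable_funM; last exact: L1_measurable (L1_poisson R).
exact: (measurableT_comp mg (measurable_affine e x)).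
Qed.

Let poisson_le e x : `|poisson e x| <= M.
Proof.
have pi0 : 0 < pi :> R by exact: pi_gt0.
rewrite /poisson normrM ger0_norm ?invr_ge0 ?pi_ge0// mulrC ler_pdivrMr//.
apply: le_trans; first apply: (norm_Rintegral_le (L1_shifted e x) _ (shifted_le e x)).
  exact/L1Z/L1_poisson.
by rewrite Rintegral_scale ?Rintegral_poisson//; exact: L1_poisson.
Qed.

Let poisson_cvg x : poisson n.+1%:R^-1 x @[n --> \oo] --> g x.
Proof.
have -> : g x = pi^-1 * \int[mu]_u (g x * (1 + u ^+ 2)^-1).
  rewrite Rintegral_scale; last exact: L1_poisson.
  by rewrite Rintegral_poisson mulrCA mulVf ?mulr1// lt0r_neq0// pi_gt0.
apply: cvgM; first exact: cvg_cst.
apply: (Rintegral_cvg (mu := mu) (g := fun u => M * (1 + u ^+ 2)^-1)).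
- by move=> n; exact: L1_measurable (L1_shifted _ _).
- apply: measurable_funM => //; exact: L1_measurable (L1_poisson R).
- apply: nearW => u; apply: cvgM; last exact: cvg_cst.
  apply: (cvg_comp (fun n => n.+1%:R^-1 * u + x) g _ (cg (x := x))).
  have H : (n.+1%:R^-1 * u + x) @[n --> \oo] --> 0 * u + x.
    by apply: cvgD; [apply: cvgM; [exact: cvg_harmonic|exact: cvg_cst]|exact: cvg_cst].
  by rewrite mul0r add0r in H.
- exact/L1Z/L1_poisson.
- by move=> n u; exact: shifted_le.
Qed.

(** Abel summation. The integral of |g^|^2 against [w e] equals that of [g] times
    its Poisson average [poisson e]. Since [w e <= 1], it is at most the integral
    of |g^|^2; since [g] is bounded and continuous, the Poisson averages converge
    to [g] as [e] tends to 0, boundedly, and the integral tends to that of g^2. *)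
Lemma plancherel_le_bounded :
  (\int[mu]_x (g x ^+ 2)%:E <= \int[mu]_t (cosT g t ^+ 2 + sinT g t ^+ 2)%:E)%E.
Proof.
pose E t := cosT g t ^+ 2 + sinT g t ^+ 2.
have E0 t : 0 <= E t by rewrite addr_ge0 ?sqr_ge0.
have mE : measurable_fun setT E.
  apply: measurable_funD; apply: measurable_funX.
    exact: measurable_cosT.
  exact: measurable_sinT.
have EN t : `|E t| <= N ^+ 2 + N ^+ 2.
  have sq u : `|u| <= N -> u ^+ 2 <= N ^+ 2.
    by move=> uN; rewrite -real_normK ?num_real// lerXn2r ?nnegrE// (le_trans _ uN).
  rewrite ger0_norm// lerD// sq//; first exact: cosT_le.
  exact: sinT_le.
have mpoisson e : measurable_fun setT (poisson e).
  apply: measurable_funM => //.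
  apply: (measurable_Rintegral_param mu
    (h := fun z : R * R => g (e * z.2 + z.1) * (1 + z.2 ^+ 2)^-1)).
  apply: measurable_funM.
    apply: measurableT_comp => //; apply: measurable_funD => //.
    exact: measurable_funM.
  apply: (measurableT_comp (f := fun u : R => (1 + u ^+ 2)^-1)) => //.
  exact: L1_measurable (L1_poisson R).
have g2 : L1 mu (fun x => g x * g x) by exact: (L1_bounded (M := M)).
have key e : 0 < e ->
    \int[mu]_t (w e t * E t) = \int[mu]_x (g x * poisson e x).
  move=> e0; rewrite abel_energy// swap1//; apply: eq_Rintegral => x _.
  under eq_Rintegral => t _ do rewrite -mulrA mulrCA.
  rewrite Rintegral_scale; last first.
    apply: (L1_bounded (M := N + N) (w1 e0)) => //.
    exact: (measurableT_comp mk (measurable_fun_pair _ _)).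
  by rewrite kernelE.
have lhs : \int[mu]_x (g x * poisson n.+1%:R^-1 x) @[n --> \oo] -->
    \int[mu]_x (g x * g x).
  apply: (Rintegral_cvg (mu := mu) (g := fun x => M * `|g x|)).
  - by move=> n; apply: measurable_funM; [exact: mg|exact: mpoisson].
  - exact: measurable_funM.
  - apply: nearW => x; apply: cvgM; first exact: cvg_cst.
    exact: poisson_cvg.
  - exact/L1Z/L1_norm.
  - by move=> n x; rewrite normrM mulrC ler_wpM2r// poisson_le.
rewrite (_ : (\int[mu]_x (g x ^+ 2)%:E)%E = (\int[mu]_x (g x * g x))%:E); last first.
  by rewrite EFin_Rintegral//; apply: eq_integral => x _; rewrite expr2.
have bound n : ((\int[mu]_x (g x * poisson n.+1%:R^-1 x))%:E <=
    \int[mu]_t (E t)%:E)%E.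
  rewrite -key ?invr_gt0// EFin_Rintegral; last first.
    apply: (L1_bounded (M := N ^+ 2 + N ^+ 2)) => //; exact: w1.
  apply: ge0_le_integral => //.
  - by move=> t _; rewrite lee_fin mulr_ge0// expR_ge0.
  - apply/measurable_EFinP; apply: measurable_funM => //.
    by apply: (L1_measurable (mu := mu)); exact: w1.
  - exact/measurable_EFinP.
  - move=> t _; rewrite lee_fin ler_piMl// /w -[leRHS]expR0 ler_expR mulNr oppr_le0.
    by rewrite !mulr_ge0// pi_ge0.
apply: (cvge_le (F := \oo) (f := fun n => (\int[mu]_x (g x * poisson n.+1%:R^-1 x))%:E)).
  exact: nearW.
apply: cvg_EFin => //; exact: nearW.
Qed.

End bounded_continuous.
End fourier_real_line.

(** * Averages over intervals *)

Section box_average.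
Context (R : realType).
Notation mu := (@lebesgue_measure R).
Variables (f : R -> R) (s : R).
Hypothesis f1 : L1 mu f.
Hypothesis s0 : 0 < s.

(** The density of the uniform law on the interval of centre 0 and radius [s]. *)
Definition box (u : R) : R := (2 * s)^-1 * ((`|u| < s)%R)%:R.
Definition box_average (x : R) := \int[mu]_y (f y * box (y - x)).

Let s20 : 0 < (2 * s)^-1. Proof. by rewrite invr_gt0 mulr_gt0. Qed.

Lemma box_ge0 u : 0 <= box u. Proof. by rewrite mulr_ge0// ltW. Qed.

Lemma boxN u : box (- u) = box u. Proof. by rewrite /box normrN. Qed.

Lemma norm_box u : `|box u| <= (2 * s)^-1.
Proof.
by rewrite ger0_norm ?box_ge0// /box; case: (`|u| < s)%R; rewrite ?mulr1// mulr0 ltW.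
Qed.

Let boxE : box = fun u => (2 * s)^-1 * \1_(`]- s, s[%classic : set R) u.
Proof.
apply/funext => u; rewrite /box indicE; congr (_ * _%:R).
by rewrite ltr_norml; congr nat_of_bool; apply/idP/idP; rewrite inE /= in_itv.
Qed.

Lemma measurable_box : measurable_fun setT box.
Proof. by rewrite boxE; apply: measurable_funM => //; exact: measurable_indic. Qed.

Lemma integral_box : (\int[mu]_u (box u)%:E = 1)%E.
Proof.
rewrite boxE; under eq_integral do rewrite EFinM.
rewrite ge0_integralZl//; last 2 first.
- by apply/measurable_EFinP; exact: measurable_indic.
- by rewrite lee_fin ltW.
have H : mu (`]- s, s[%classic : set R) = (2 * s)%:E.
  by rewrite lebesgue_measure_itv/= lte_fin gtrN// -EFinB; congr EFin; ring.
rewrite integral_indic// setIT.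
transitivity ((((2 * s)^-1)%:E * (2 * s)%:E)%E); first by congr (_ * _)%E; exact: H.
by rewrite -EFinM mulVf// lt0r_neq0// mulr_gt0.
Qed.

Lemma L1_box : L1 mu box.
Proof.
apply: L1_fin; first exact: measurable_box.
by under eq_integral do rewrite ger0_norm ?box_ge0//; rewrite integral_box ltry.
Qed.

Lemma Rintegral_box : \int[mu]_u box u = 1.
Proof. by rewrite /Rintegral integral_box. Qed.

Lemma integral_box_shift y : (\int[mu]_x (box (y - x))%:E = 1)%E.
Proof.
rewrite -integral_box -(ge0_integral_shift (- y) (f := fun u => (box u)%:E)).
- by apply: eq_integral => x _; rewrite -boxN opprB.
- by apply/measurable_EFinP; exact: measurable_box.
- by move=> x; rewrite lee_fin box_ge0.
Qed.

Lemma measurable_box_diff : measurable_fun setT (fun z : R * R => box (z.2 - z.1)).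
Proof. by apply: (measurableT_comp measurable_box); exact: measurable_funB. Qed.

Lemma L1_box_prod : L1 (mu \x mu)%E (fun z : R * R => f z.2 * box (z.2 - z.1)).
Proof.
have mf := L1_measurable f1.
have mh : measurable_fun setT (fun z : R * R => f z.2 * box (z.2 - z.1)).
  by apply: measurable_funM; [exact: measurableT_comp|exact: measurable_box_diff].
apply/integrable21ltyP; first exact/measurable_EFinP.
have /integrableP[_] := f1; apply: le_lt_trans.
rewrite le_eqVlt; apply/orP; left; apply/eqP; apply: eq_integral => y _ /=.
under eq_integral => x _ do rewrite normrM EFinM (ger0_norm (box_ge0 _)).
rewrite ge0_integralZl//.
- by rewrite integral_box_shift mule1.
- apply/measurable_EFinP/(measurableT_comp measurable_box).
  exact: measurable_funB.
- by move=> x _; rewrite lee_fin box_ge0.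
Qed.

Lemma L1_box_average : L1 mu box_average.
Proof. exact: (L1_Rintegral1 L1_box_prod). Qed.

Lemma L1_mul_box x : L1 mu (fun y => f y * box (y - x)).
Proof.
apply: (L1_bounded (M := (2 * s)^-1) f1); last by move=> y; exact: norm_box.
by apply: (measurableT_comp measurable_box); exact: measurable_funB.
Qed.

Lemma norm_box_average x : `|box_average x| <= (2 * s)^-1 * \int[mu]_y `|f y|.
Proof.
rewrite -Rintegral_scale; last exact: L1_norm.
apply: norm_Rintegral_le; [exact: L1_mul_box|exact/L1Z/L1_norm|move=> y].
by rewrite normrM mulrC ler_wpM2r// norm_box.
Qed.

(** The intervals of centres [u n] and [x] only disagree, in the limit, at the two
    end points of the latter: dominated convergence applies. *)
Lemma continuous_box_average : continuous box_average.
Proof.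
move=> x; apply/(@cvg_nbhsP _ R^o) => u ux.
apply: (Rintegral_cvg (mu := mu) (g := fun y => (2 * s)^-1 * `|f y|)).
- by move=> n; exact: L1_measurable (L1_mul_box _).
- exact: L1_measurable (L1_mul_box _).
- exists [set x - s; x + s]; split; first exact: measurableU.
    by apply: countable_lebesgue_measure0; exact: finite_set_countable.
  move=> y /= nP; apply: contrapT => yx; apply: nP.
  apply: cvgM; first exact: cvg_cst.
  apply: cvgM; first exact: cvg_cst.
  have H : `|y - u n| @[n --> \oo] --> `|y - x|.
    by apply: cvg_norm; apply: cvgB => //; exact: cvg_cst.
  have [yxs|yxs|yxs] := ltgtP `|y - x| s.
  + apply: cvg_near_cst; move/cvgr_lt : H => /(_ s yxs).
    by apply: filterS => n ->.
  + apply: cvg_near_cst; move/cvgr_gt : H => /(_ s yxs).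
    by apply: filterS => n ns; rewrite ltNge ltW.
  + exfalso; apply: yx; move: yxs.
    have [|] := leP 0 (y - x) => yx0.
      by rewrite ger0_norm// => <-; right; rewrite addrC subrK.
    by rewrite ltr0_norm// => <-; left; rewrite opprK addrC subrK.
- exact/L1Z/L1_norm.
- by move=> n y; rewrite normrM mulrC ler_wpM2r// norm_box.
Qed.

Lemma Rintegral_box_odd t : sinT box t = 0.
Proof.
suff H : sinT box t = - sinT box t by lra.
rewrite {1}/sinT (Rintegral_substitution (@measurable_opp R) (c := 1) _ _ ltr01).
- rewrite mul1r -mulN1r -Rintegral_scale; last exact/L1_sin/L1_box.
  by apply: eq_Rintegral => x _; rewrite boxN mulNr mulrN sinN; ring.
- by move=> h mh h0; rewrite mul1e ge0_integral_opp.
- exact/L1_sin/L1_box.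
Qed.

Let kappa t := cosT box t.

Lemma norm_kappa_le1 t : `|kappa t| <= 1.
Proof.
apply: (le_trans (cosT_le _ L1_box)); rewrite -[leRHS]Rintegral_box.
by rewrite le_eqVlt; apply/orP; left; apply/eqP; apply: eq_Rintegral => u _;
  rewrite ger0_norm// box_ge0.
Qed.

Let box_trig (phi : R -> R) y t (m1 : measurable_fun setT phi) :
  (forall u, `|phi u| <= 1) ->
  \int[mu]_x (box (y - x) * phi (2 * pi * (x * t))) =
  \int[mu]_u (box u * phi (2 * pi * (u * t) + 2 * pi * (y * t))).
Proof.
move=> phi1.
rewrite (Rintegral_substitution (measurable_affine 1 y) (c := 1) _ _ ltr01).
- rewrite mul1r; apply: eq_Rintegral => u _.
  by rewrite -boxN opprB mul1r addrK; congr (_ * phi _); ring.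
- by move=> h mh h0; rewrite -(ge0_integral_affine y ltr01)// mul1e.
- rewrite (_ : (fun x => _) = fun x => (box (x - y) * phi (2 * pi * (x * t)))%:E); last first.
    by apply/funext => x; rewrite -boxN opprB.
  apply: (L1_bounded (M := 1)) => //.
    have H : L1 mu (fun x : R => box (1 * x + (- y))).
      apply: (L1_substitution (measurable_affine 1 (- y)) (c := 1) _ L1_box ltr01).
      by move=> h mh h0; rewrite -(ge0_integral_affine (- y) ltr01)// mul1e.
    by move: H; under eq_fun do rewrite mul1r.
  by apply: (measurableT_comp m1); exact: measurable_phase1.
Qed.

Let box_cos y t :
  \int[mu]_x (box (y - x) * cos (2 * pi * (x * t))) = kappa t * cos (2 * pi * (y * t)).
Proof.
rewrite box_trig; [|exact: measurable_cos_comp|exact: norm_cos_le1].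
under eq_Rintegral => u _.
  rewrite cosD (_ : _ * _ = cos (2 * pi * (y * t)) * (box u * cos (2 * pi * (u * t))) -
   sin (2 * pi * (y * t)) * (box u * sin (2 * pi * (u * t)))); last by ring.
  over.
rewrite Rintegral_sub; [|exact/L1Z/L1_cos/L1_box|exact/L1Z/L1_sin/L1_box].
rewrite !Rintegral_scale; [|exact/L1_sin/L1_box|exact/L1_cos/L1_box].
by rewrite -/(sinT box t) Rintegral_box_odd mulr0 subr0 mulrC.
Qed.

Let box_sin y t :
  \int[mu]_x (box (y - x) * sin (2 * pi * (x * t))) = kappa t * sin (2 * pi * (y * t)).
Proof.
rewrite box_trig; [|exact: measurable_sin_comp|exact: norm_sin_le1].
under eq_Rintegral => u _.
  rewrite sinD (_ : _ * _ = cos (2 * pi * (y * t)) * (box u * sin (2 * pi * (u * t))) +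
   sin (2 * pi * (y * t)) * (box u * cos (2 * pi * (u * t)))); last by ring.
  over.
rewrite Rintegral_add; [|exact/L1Z/L1_sin/L1_box|exact/L1Z/L1_cos/L1_box].
rewrite !Rintegral_scale; [|exact/L1_cos/L1_box|exact/L1_sin/L1_box].
by rewrite -/(sinT box t) Rintegral_box_odd mulr0 add0r mulrC.
Qed.

Let average_trig (phi : R -> R) t (m1 : measurable_fun setT phi) :
  (forall u, `|phi u| <= 1) ->
  (forall y, \int[mu]_x (box (y - x) * phi (2 * pi * (x * t))) =
    kappa t * phi (2 * pi * (y * t))) ->
  \int[mu]_x (box_average x * phi (2 * pi * (x * t))) =
  kappa t * \int[mu]_y (f y * phi (2 * pi * (y * t))).
Proof.
move=> phi1 Hphi.
have mphi : measurable_fun setT (fun x : R => phi (2 * pi * (x * t))).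
  by apply: (measurableT_comp m1); exact: measurable_phase1.
transitivity (\int[mu]_x \int[mu]_y (f y * box (y - x) * phi (2 * pi * (x * t)))).
  apply: eq_Rintegral => x _; rewrite mulrC -Rintegral_scale; last exact: L1_mul_box.
  by apply: eq_Rintegral => y _; rewrite mulrC.
rewrite (Rintegral_swap (m1 := mu) (m2 := mu)
  (h := fun z : R * R => f z.2 * box (z.2 - z.1) * phi (2 * pi * (z.1 * t)))); last first.
  apply: (L1_bounded (M := 1) L1_box_prod) => //.
  exact: (measurableT_comp mphi).
rewrite -Rintegral_scale; last first.
  by apply: (L1_bounded (M := 1) f1).
apply: eq_Rintegral => y _.
rewrite -[RHS]mulrCA -Hphi -Rintegral_scale.
  by apply: eq_Rintegral => x _; rewrite /= -mulrA.
apply: (L1_bounded (M := 1)) => //.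
have H : L1 mu (fun x : R => box (1 * x + (- y))).
  apply: (L1_substitution (measurable_affine 1 (- y)) (c := 1) _ L1_box ltr01).
  by move=> h mh h0; rewrite -(ge0_integral_affine (- y) ltr01)// mul1e.
rewrite (_ : (fun x => _) = fun x : R => (box (1 * x - y))%:E)//.
by apply/funext => x; rewrite mul1r -boxN opprB.
Qed.

(** The averages are bounded and continuous, and averaging multiplies the
    transform by [cosT box], which is at most 1 in modulus, the sine transform of
    the even function [box] being zero. *)
Lemma plancherel_le_box_average :
  (\int[mu]_x (box_average x ^+ 2)%:E <=
   \int[mu]_t (cosT f t ^+ 2 + sinT f t ^+ 2)%:E)%E.
Proof.
have mf := L1_measurable f1.
apply: le_trans.
  apply: plancherel_le_bounded; [exact: L1_box_average|exact: norm_box_average|].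
  exact: continuous_box_average.
have mg := L1_measurable L1_box_average.
apply: ge0_le_integral => //.
- by move=> t _; rewrite lee_fin addr_ge0 ?sqr_ge0.
- apply/measurable_EFinP; apply: measurable_funD; apply: measurable_funX;
    [exact: measurable_cosT|exact: measurable_sinT].
- apply/measurable_EFinP; apply: measurable_funD; apply: measurable_funX;
    [exact: measurable_cosT|exact: measurable_sinT].
move=> t _; rewrite lee_fin /cosT /sinT.
rewrite (average_trig (phi := cos)) //; [|exact: measurable_cos_comp|exact: norm_cos_le1].
rewrite (average_trig (phi := sin)) //; [|exact: measurable_sin_comp|exact: norm_sin_le1].
rewrite !exprMn -mulrDr ler_piMl ?addr_ge0 ?sqr_ge0//.
by rewrite -real_normK ?num_real// exprn_ile1// norm_kappa_le1.
Qed.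

End box_average.

(** * Plancherel's inequality for integrable functions on the line *)

Section limits.
Context d (T : measurableType d) (R : realType) (mu : {measure set T -> \bar R}).

Lemma ae_imply (P Q : T -> Prop) : (forall x, P x -> Q x) ->
  {ae mu, forall x, P x} -> {ae mu, forall x, Q x}.
Proof. by move=> PQ; apply: filterS. Qed.

Lemma measurable_patch (D : set T) (h : T -> \bar R) : measurable D ->
  measurable_fun D h -> measurable_fun setT (h \_ D).
Proof. by move=> mD /(measurable_restrictT _ mD). Qed.

Lemma limn_einf_le (u : nat -> \bar R) (c : \bar R) : (forall n, (u n <= c)%E) ->
  (limn_einf u <= c)%E.
Proof.
move=> uc; rewrite limn_einf_lim; apply: lime_le; first exact: is_cvg_einfs.
apply: nearW => n; apply: (le_trans _ (uc n)); apply: ereal_inf_lbound.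
by exists n => /=.
Qed.

Lemma measurable_limn_einf (g : nat -> T -> \bar R) :
  (forall n, measurable_fun setT (g n)) ->
  measurable_fun setT (fun x => limn_einf (g ^~ x)).
Proof.
move=> mg; apply: (emeasurable_fun_cvg (fun n x => einfs (g ^~ x) n)).
  by move=> n; exact: measurable_fun_einfs.
by move=> x _; rewrite limn_einf_lim; exact: is_cvg_einfs.
Qed.

(** Fatou's lemma, for a sequence that converges almost everywhere. *)
Lemma fatou_le (g : nat -> T -> \bar R) (f : T -> \bar R) (c : \bar R) :
  (forall n, measurable_fun setT (g n)) -> measurable_fun setT f ->
  (forall n x, (0 <= g n x)%E) ->
  {ae mu, forall x, g n x @[n --> \oo] --> f x} ->
  (forall n, (\int[mu]_x g n x <= c)%E) -> (\int[mu]_x f x <= c)%E.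
Proof.
move=> mg mf g0 gf gc.
rewrite (@ae_eq_integral _ _ _ mu setT (fun x => limn_einf (g ^~ x))) => //.
- apply: (le_trans (fatou mu measurableT mg _)) => //.
  exact: limn_einf_le.
- exact: measurable_limn_einf.
- apply: ae_imply gf => x gx _.
  by have [-> _] := cvg_limn_einf_sup gx.
Qed.

End limits.

Section plancherel_real_line.
Context (R : realType).
Notation mu := (@lebesgue_measure R).

(** The left-hand side averages f(y) - f(x), and [davg] its absolute value. *)
Lemma box_average_davg (f : R -> R) s x : L1 mu f -> 0 < s ->
  (`|(box_average f s x - f x)%:E| <= davg f x s)%E.
Proof.
move=> f1 s0.
have mf := L1_measurable f1.
have mb : measurable_fun setT (fun y : R => box s (y - x)).
  by apply: (measurableT_comp (measurable_box s)); exact: measurable_funB.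
have b1 : L1 mu (fun y : R => box s (y - x)).
  have := L1_substitution (measurable_affine 1 (- x)) (c := 1) _ (L1_box s0) ltr01.
  under eq_fun do rewrite mul1r; apply.
  by move=> h mh h0; rewrite -(ge0_integral_affine (- x) ltr01)// mul1e.
have bx1 : \int[mu]_y box s (y - x) = 1.
  by rewrite /Rintegral (ge0_integral_shift (- x) (f := fun u => (box s u)%:E))//
    ?integral_box//; [by apply/measurable_EFinP; exact: measurable_box|
    move=> u; rewrite lee_fin box_ge0].
have d1 : L1 mu (fun y => (f y - f x) * box s (y - x)).
  under eq_fun do rewrite mulrBl.
  by apply: L1B; [exact: L1_mul_box|exact: L1Z].
have -> : box_average f s x - f x = \int[mu]_y ((f y - f x) * box s (y - x)).
  under eq_Rintegral do rewrite mulrBl.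
  rewrite Rintegral_sub; [|exact: L1_mul_box|exact: L1Z].
  by rewrite Rintegral_scale// bx1 mulr1.
rewrite EFin_Rintegral//; apply: (le_trans (le_abse_integral _ _ _)) => //.
  exact: (measurable_int mu).
rewrite /davg /iavg lebesgue_measure_ball; last exact: ltW.
rewrite inver.
rewrite (_ : s *+ 2 == 0 = false); last by apply/negbTE; rewrite lt0r_neq0// mulrn_wgt0.
rewrite -ge0_integralZl//; last 3 first.
- exact: measurable_ball.
- apply: measurableT_comp => //; apply/measurable_EFinP; apply: measurable_funTS.
  exact: measurable_funD.
- by rewrite lee_fin invr_ge0 ltW// mulrn_wgt0.
rewrite [leRHS]integral_mkcond; apply: ge0_le_integral => //.
- by apply: measurableT_comp => //; exact: (measurable_int mu).
- apply: measurable_patch; first exact: measurable_ball.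
  apply: emeasurable_funM => //; apply: measurableT_comp => //.
  by apply/measurable_EFinP; apply: measurable_funTS; exact: measurable_funD.
move=> y _; rewrite patchE /box distrC.
case: ifPn => [|]; rewrite ?inE ?notin_setE => yB.
  have -> : (`|x - y| < s)%R by exact: yB.
  rewrite mulr1 -EFinM lee_fin normrM mulrC -[s *+ 2]mulr_natl.
  by rewrite [X in X * _ <= _]ger0_norm// invr_ge0 ltW// mulr_gt0.
have -> : (`|x - y| < s)%R = false by apply/negP.
by rewrite !mulr0 /= normr0.
Qed.

(** Fatou's lemma along the averages of radius 1/(n+1), which converge to [f] at its
    Lebesgue points, hence almost everywhere. *)
Lemma plancherel_le_real (f : R -> R) : L1 mu f ->
  (\int[mu]_x (f x ^+ 2)%:E <= \int[mu]_t (cosT f t ^+ 2 + sinT f t ^+ 2)%:E)%E.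
Proof.
move=> f1; have mf := L1_measurable f1.
pose s n : R := n.+1%:R^-1.
have s0 n : 0 < s n by rewrite invr_gt0.
pose g n x := (box_average f (s n) x ^+ 2)%:E.
have mbox n : measurable_fun setT (box_average f (s n)).
  exact: L1_measurable (L1_box_average f1 (s0 n)).
have mg n : measurable_fun setT (g n).
  by apply/measurable_EFinP; apply: measurable_funX.
have lf : locally_integrable setT f.
  apply: open_integrable_locally => //; exact: openT.
have cvgf : {ae mu, forall x, g n x @[n --> \oo] --> (f x ^+ 2)%:E}.
  apply: ae_imply (lebesgue_differentiation lf) => x fx.
  apply: cvg_EFin; first exact: nearW.
  suff H : box_average f (s n) x @[n --> \oo] --> f x.
    by rewrite /g /=; under eq_fun do rewrite expr2; rewrite expr2; exact: cvgM.
  have H : davg f x (s n) @[n --> \oo] --> 0%E.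
    move/cvge_at_rightP : fx => /(_ s) fx; apply: fx.
    by split => //; exact: cvg_harmonic.
  apply/subr_cvg0; apply/cvgr0Pnorm_le => e e0.
  have := H; move/fine_cvgP => [fin /cvgr0_norm_lt] /(_ e e0).
  move=> H2; near=> n.
  have := box_average_davg x f1 (s0 n).
  have dn : davg f x (s n) \is a fin_num by near: n.
  rewrite -(fineK dn) lee_fin => /le_trans; apply.
  apply/ltW/(le_lt_trans (ler_norm _)); near: n; exact: H2.
apply: (fatou_le (mu := mu) (g := g)) => //.
- by apply/measurable_EFinP; exact: measurable_funX.
- by move=> n x; rewrite lee_fin sqr_ge0.
- by move=> n; exact: plancherel_le_box_average.
Unshelve. all: by end_near. Qed.

End plancherel_real_line.
Notation L1C mu f := (L1 mu (fun x => complex.Re (f x)) /\ L1 mu (fun x => complex.Im (f x))).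

Section complex_line.
Context (R : realType).
Notation mu := (@lebesgue_measure R).

Lemma sqr_normcE (z : R[i]) : normc z ^+ 2 = complex.Re z ^+ 2 + complex.Im z ^+ 2.
Proof. by case: z => a b /=; rewrite sqr_sqrtr// addr_ge0 ?sqr_ge0. Qed.

Lemma Re_expi2piM s (z : R[i]) : complex.Re (expi2pi s * z) =
  complex.Re z * cos (2 * pi * s) - complex.Im z * sin (2 * pi * s).
Proof. by case: z => a b /=; rewrite mulrC [X in _ - X]mulrC. Qed.

Lemma Im_expi2piM s (z : R[i]) : complex.Im (expi2pi s * z) =
  complex.Im z * cos (2 * pi * s) + complex.Re z * sin (2 * pi * s).
Proof. by case: z => a b /=; rewrite mulrC [X in _ + X]mulrC. Qed.

Definition fourier_line (f : R -> R[i]) (t : R) : R[i] :=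
  cintegral mu setT (fun a => expi2pi (a * t) * f a).

Variable f : R -> R[i].
Hypothesis f1 : L1C mu f.
Let u a := complex.Re (f a).
Let v a := complex.Im (f a).
Let u1 : L1 mu u := f1.1.
Let v1 : L1 mu v := f1.2.

Lemma Re_fourier_line t : complex.Re (fourier_line f t) = cosT u t - sinT v t.
Proof.
rewrite /fourier_line /cintegral /= /cosT /sinT -Rintegral_sub; [|exact: L1_cos|exact: L1_sin].
by apply: eq_Rintegral => a _; rewrite Re_expi2piM.
Qed.

Lemma Im_fourier_line t : complex.Im (fourier_line f t) = cosT v t + sinT u t.
Proof.
rewrite /fourier_line /cintegral /= /cosT /sinT -Rintegral_add; [|exact: L1_cos|exact: L1_sin].
by apply: eq_Rintegral => a _; rewrite Im_expi2piM.
Qed.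

Lemma cosTN (g : R -> R) t : cosT g (- t) = cosT g t.
Proof. by apply: eq_Rintegral => a _; rewrite mulrN mulrN cosN. Qed.

Lemma sinTN (g : R -> R) t : L1 mu g -> sinT g (- t) = - sinT g t.
Proof.
move=> g1; rewrite -[RHS]mulN1r -Rintegral_scale; last exact: L1_sin.
by apply: eq_Rintegral => a _; rewrite mulrN mulrN sinN mulrN mulN1r.
Qed.

(** At opposite frequencies the transforms of the real and imaginary parts are
    combined with opposite signs, so that the cross terms cancel in the sum. *)
Lemma parallelogram_fourier_line t :
  cosT u t ^+ 2 + sinT u t ^+ 2 + (cosT v t ^+ 2 + sinT v t ^+ 2) =
  2^-1 * (normc (fourier_line f t) ^+ 2 + normc (fourier_line f (- t)) ^+ 2).
Proof.
rewrite !sqr_normcE !Re_fourier_line !Im_fourier_line !cosTN !sinTN//.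
by move: (cosT u t) (sinT u t) (cosT v t) (sinT v t) => a b a' b'; field.
Qed.

Lemma measurable_fourier_line : measurable_fun setT (fun t => normc (fourier_line f t) ^+ 2).
Proof.
rewrite (_ : (fun t => _) = fun t => (cosT u t - sinT v t) ^+ 2 + (cosT v t + sinT u t) ^+ 2).
  have mu1 := L1_measurable u1; have mv1 := L1_measurable v1.
  apply: measurable_funD; apply: measurable_funX.
    apply: measurable_funB; first exact: measurable_cosT.
    exact: measurable_sinT.
  apply: measurable_funD; first exact: measurable_cosT.
  exact: measurable_sinT.
by apply/funext => t; rewrite sqr_normcE Re_fourier_line Im_fourier_line.
Qed.

(** By the parallelogram identity, the integral of |f^|^2 is the sum of those of the
    real and imaginary parts, since the line is symmetric. *)
Lemma plancherel_le_line :
  (\int[mu]_x (normc (f x) ^+ 2)%:E <= \int[mu]_t (normc (fourier_line f t) ^+ 2)%:E)%E.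
Proof.
have mu1 := L1_measurable u1; have mv1 := L1_measurable v1.
under eq_integral do rewrite sqr_normcE EFinD.
rewrite ge0_integralD//; last 4 first.
- by move=> x _; rewrite lee_fin sqr_ge0.
- by apply/measurable_EFinP; exact: measurable_funX.
- by move=> x _; rewrite lee_fin sqr_ge0.
- by apply/measurable_EFinP; exact: measurable_funX.
have mE g : L1 mu g -> measurable_fun setT (fun t => (cosT g t ^+ 2 + sinT g t ^+ 2)%:E).
  move=> g1; have mg := L1_measurable g1.
  apply/measurable_EFinP; apply: measurable_funD; apply: measurable_funX.
    exact: measurable_cosT.
  exact: measurable_sinT.
apply: (le_trans (leeD (plancherel_le_real u1) (plancherel_le_real v1))).
rewrite -ge0_integralD//; last 4 first.
- by move=> x _; rewrite lee_fin addr_ge0 ?sqr_ge0.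
- exact: mE.
- by move=> x _; rewrite lee_fin addr_ge0 ?sqr_ge0.
- exact: mE.
pose A t := (normc (fourier_line f t) ^+ 2)%:E.
have mA : measurable_fun setT A by apply/measurable_EFinP; exact: measurable_fourier_line.
have A0 t : (0 <= A t)%E by rewrite lee_fin sqr_ge0.
have mAN : measurable_fun setT (fun t : R => A (- t)) by apply: measurableT_comp.
have -> : (\int[mu]_t ((cosT u t ^+ 2 + sinT u t ^+ 2)%:E +
    (cosT v t ^+ 2 + sinT v t ^+ 2)%:E) =
    \int[mu]_t ((2^-1)%:E * (A t + A (- t)%R)))%E.
  by apply: eq_integral => t _; rewrite -!EFinD -EFinM parallelogram_fourier_line.
rewrite ge0_integralZl//; last 2 first.
- exact: emeasurable_funD.
- by move=> t _; rewrite adde_ge0.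
rewrite ge0_integralD// ge0_integral_opp// -[X in (_ * X)%E]mule2n -mule_natl muleA.
by rewrite -EFinM mulVf// mul1e.
Qed.

End complex_line.

(** * Integrals of complex functions *)

Section complex_integrals.
Context d (T : measurableType d) (R : realType) (mu : {measure set T -> \bar R}).
Implicit Types f g : T -> R[i].

Lemma ReD (z w : R[i]) : complex.Re (z + w) = complex.Re z + complex.Re w.
Proof. by case: z w => [? ?] [? ?]. Qed.

Lemma ImD (z w : R[i]) : complex.Im (z + w) = complex.Im z + complex.Im w.
Proof. by case: z w => [? ?] [? ?]. Qed.

Lemma ReB (z w : R[i]) : complex.Re (z - w) = complex.Re z - complex.Re w.
Proof. by case: z w => [? ?] [? ?]. Qed.

Lemma ImB (z w : R[i]) : complex.Im (z - w) = complex.Im z - complex.Im w.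
Proof. by case: z w => [? ?] [? ?]. Qed.

Lemma ReM (z w : R[i]) : complex.Re (z * w) =
  complex.Re z * complex.Re w - complex.Im z * complex.Im w.
Proof. by case: z w => [? ?] [? ?]. Qed.

Lemma ImM (z w : R[i]) : complex.Im (z * w) =
  complex.Re z * complex.Im w + complex.Im z * complex.Re w.
Proof. by case: z w => [? ?] [? ?]. Qed.

Lemma complex_eq (z w : R[i]) : complex.Re z = complex.Re w ->
  complex.Im z = complex.Im w -> z = w.
Proof. by case: z w => [? ?] [? ?] /= -> ->. Qed.

Lemma normc_expi2pi (t : R) : normc (expi2pi t) = 1.
Proof. by rewrite /= cos2Dsin2 sqrtr1. Qed.

Lemma expi2piD (s t : R) : expi2pi (s + t) = expi2pi s * expi2pi t.
Proof.
apply: complex_eq; rewrite ?ReM ?ImM /= mulrDr ?cosD ?sinD//.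
by rewrite addrC [X in X + _]mulrC [X in _ + X = _]mulrC; congr (_ + _); rewrite mulrC.
Qed.

Lemma L1C_measurable f : L1C mu f -> cmeasurable_fun setT f.
Proof. by move=> [f1 f2]; split; [exact: L1_measurable f1|exact: L1_measurable f2]. Qed.

Lemma cmeasurable_funM f g : cmeasurable_fun setT f -> cmeasurable_fun setT g ->
  cmeasurable_fun setT (fun x => f x * g x).
Proof.
move=> [f1 f2] [g1 g2]; split.
  by under eq_fun do rewrite ReM; apply: measurable_funB; apply: measurable_funM.
by under eq_fun do rewrite ImM; apply: measurable_funD; apply: measurable_funM.
Qed.

Lemma cmeasurable_funD f g : cmeasurable_fun setT f -> cmeasurable_fun setT g ->
  cmeasurable_fun setT (fun x => f x + g x).
Proof.
move=> [f1 f2] [g1 g2]; split.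
  by under eq_fun do rewrite ReD; apply: measurable_funD.
by under eq_fun do rewrite ImD; apply: measurable_funD.
Qed.

Lemma cmeasurable_cst (c : R[i]) : cmeasurable_fun setT (fun _ : T => c).
Proof. by split; exact: measurable_cst. Qed.

Lemma cmeasurable_expi2pi (u : T -> R) : measurable_fun setT u ->
  cmeasurable_fun setT (fun x => expi2pi (u x)).
Proof.
move=> mu_; split => /=; [apply: measurable_cos_comp|apply: measurable_sin_comp];
  exact: measurable_funM.
Qed.

Lemma measurable_sqr_normc f : cmeasurable_fun setT f ->
  measurable_fun setT (fun x => normc (f x) ^+ 2).
Proof.
move=> [f1 f2]; under eq_fun do rewrite sqr_normcE.
by apply: measurable_funD; apply: measurable_funX.
Qed.

Lemma L1CD f g : L1C mu f -> L1C mu g -> L1C mu (fun x => f x + g x).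
Proof.
move=> [f1 f2] [g1 g2]; split.
  by under eq_fun do rewrite ReD; exact: L1D.
by under eq_fun do rewrite ImD; exact: L1D.
Qed.

Lemma L1CZ (c : R[i]) f : L1C mu f -> L1C mu (fun x => c * f x).
Proof.
move=> [f1 f2]; split.
  by under eq_fun do rewrite ReM; apply: L1B; exact: L1Z.
by under eq_fun do rewrite ImM; apply: L1D; exact: L1Z.
Qed.

Lemma L1C_expi2piM (u : T -> R) f : measurable_fun setT u -> L1C mu f ->
  L1C mu (fun x => expi2pi (u x) * f x).
Proof.
move=> mu_ [f1 f2].
have mc : measurable_fun setT (fun x => cos (2 * pi * u x)).
  by apply: measurable_cos_comp; exact: measurable_funM.
have ms : measurable_fun setT (fun x => sin (2 * pi * u x)).
  by apply: measurable_sin_comp; exact: measurable_funM.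
split.
  under eq_fun do rewrite Re_expi2piM.
  apply: L1B; apply: (L1_bounded (M := 1)) => // x.
    exact: norm_cos_le1.
  exact: norm_sin_le1.
under eq_fun do rewrite Im_expi2piM.
apply: L1D; apply: (L1_bounded (M := 1)) => // x.
  exact: norm_cos_le1.
exact: norm_sin_le1.
Qed.

Lemma eq_cintegral f g : f =1 g -> cintegral mu setT f = cintegral mu setT g.
Proof. by move=> /funext ->. Qed.

Lemma cintegralD f g : L1C mu f -> L1C mu g ->
  cintegral mu setT (fun x => f x + g x) = cintegral mu setT f + cintegral mu setT g.
Proof.
move=> [f1 f2] [g1 g2]; apply: complex_eq; rewrite ?ReD ?ImD /= -Rintegral_add//.
  by apply: eq_Rintegral => x _; rewrite ReD.
by apply: eq_Rintegral => x _; rewrite ImD.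
Qed.

Lemma cintegralZ (c : R[i]) f : L1C mu f ->
  cintegral mu setT (fun x => c * f x) = c * cintegral mu setT f.
Proof.
move=> [f1 f2]; apply: complex_eq; rewrite ?ReM ?ImM /= -!Rintegral_scale//.
  rewrite -Rintegral_sub; [|exact: L1Z|exact: L1Z].
  by apply: eq_Rintegral => x _; rewrite ReM.
rewrite -Rintegral_add; [|exact: L1Z|exact: L1Z].
by apply: eq_Rintegral => x _; rewrite ImM.
Qed.

Lemma Rintegral_ae_eq (u v : T -> R) : measurable_fun setT u -> measurable_fun setT v ->
  {ae mu, forall x, u x = v x} -> \int[mu]_x u x = \int[mu]_x v x.
Proof.
move=> mu_ mv uv; congr fine; apply: ae_eq_integral => //.
- exact/measurable_EFinP.
- exact/measurable_EFinP.
- by apply: ae_imply uv => x ->.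
Qed.

Lemma cintegral_ae_eq f g : cmeasurable_fun setT f -> cmeasurable_fun setT g ->
  {ae mu, forall x, f x = g x} -> cintegral mu setT f = cintegral mu setT g.
Proof.
move=> [f1 f2] [g1 g2] fg; apply: complex_eq => /=.
  by apply: Rintegral_ae_eq => //; apply: ae_imply fg => x ->.
by apply: Rintegral_ae_eq => //; apply: ae_imply fg => x ->.
Qed.

End complex_integrals.

Section complex_fubini.
Context d1 d2 (T1 : measurableType d1) (T2 : measurableType d2) (R : realType).
Variables (m1 : {sigma_finite_measure set T1 -> \bar R})
          (m2 : {sigma_finite_measure set T2 -> \bar R}).
Implicit Type h : T1 * T2 -> R[i].

Lemma cintegral12 h : L1C (m1 \x m2)%E h ->
  cintegral m1 setT (fun x => cintegral m2 setT (fun y => h (x, y))) =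
  cintegral (m1 \x m2)%E setT h.
Proof.
move=> [h1 h2]; apply: complex_eq => /=.
  exact: (Rintegral12 h1).
exact: (Rintegral12 h2).
Qed.

Lemma cmeasurable_cintegral_param h : cmeasurable_fun setT h ->
  cmeasurable_fun setT (fun x => cintegral m2 setT (fun y => h (x, y))).
Proof.
move=> [h1 h2]; split.
  exact: (measurable_Rintegral_param m2 h1).
exact: (measurable_Rintegral_param m2 h2).
Qed.

Lemma L1C_cintegral1 h : L1C (m1 \x m2)%E h ->
  L1C m1 (fun x => cintegral m2 setT (fun y => h (x, y))).
Proof.
move=> [h1 h2]; split.
  exact: (L1_Rintegral1 h1).
exact: (L1_Rintegral1 h2).
Qed.

Lemma ae_L1C_slice h : L1C (m1 \x m2)%E h ->
  {ae m1, forall x, L1C m2 (fun y => h (x, y))}.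
Proof.
move=> [h1 h2]; have a1 := ae_integrable1 h1; have a2 := ae_integrable1 h2.
by apply: filterS2 a1 a2.
Qed.

End complex_fubini.

(** * Plancherel's inequality for row vectors *)

Section plancherel_rV.
Context (R : realType).
Notation mu := (@lebesgue_measure R).
Notation lam := (@lebesgue_rV R).

Lemma measurable_dotp d (T : measurableType d) n (u v : T -> 'rV[R]_n) :
  measurable_fun setT u -> measurable_fun setT v ->
  measurable_fun setT (fun t => dotp (u t) (v t)).
Proof.
move=> mu_ mv; apply: measurable_sum => i; apply: measurable_funM.
  exact: (measurableT_comp (measurable_coord_rV i) mu_).
exact: (measurableT_comp (measurable_coord_rV i) mv).
Qed.

Lemma measurable_dotpr n (s : 'rV[R]_n) : measurable_fun setT (fun x : 'rV[R]_n => dotp x s).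
Proof. by apply: measurable_dotp. Qed.

Lemma dotp_cons n a b (v w : 'rV[R]_n) :
  dotp (cons_rV (a, v)) (cons_rV (b, w)) = a * b + dotp v w.
Proof.
rewrite /dotp big_ord_recl !cons_rV0 /=; congr (_ + _).
by apply: eq_bigr => i _; rewrite !cons_rV_lift.
Qed.

Lemma measurable_fourier n (f : 'rV[R]_n -> R[i]) : cmeasurable_fun setT f ->
  cmeasurable_fun setT (fourier f).
Proof.
move=> [m1 m2]; apply: (cmeasurable_cintegral_param (lam n)
  (h := fun z : 'rV[R]_n * 'rV[R]_n => expi2pi (dotp z.2 z.1) * f z.2)).
apply: cmeasurable_funM.
  by apply: cmeasurable_expi2pi; apply: measurable_dotp.
split.
  exact: (measurableT_comp (f := fun x => complex.Re (f x)) m1 measurable_snd).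
exact: (measurableT_comp (f := fun x => complex.Im (f x)) m2 measurable_snd).
Qed.

Section step.
Variables (n : nat) (f : 'rV[R]_n.+1 -> R[i]).
Hypothesis f1 : L1C (lam n.+1) f.
Hypothesis IH : forall g : 'rV[R]_n -> R[i], L1C (lam n) g ->
  (\int[lam n]_x (normc (g x) ^+ 2)%:E <= \int[lam n]_x (normc (fourier g x) ^+ 2)%:E)%E.

Let F (a : R) (w : 'rV[R]_n) := fourier (fun v => f (cons_rV (a, v))) w.

Let fc1 : L1C (mu \x lam n)%E (fun p => f (cons_rV p)).
Proof. by case: f1 => ? ?; split; apply: (L1_rVS (f := fun x => _ (f x))). Qed.

Let mF : cmeasurable_fun setT (fun z : R * 'rV[R]_n => F z.1 z.2).
Proof.
have [m1 m2] := L1C_measurable fc1.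
apply: (cmeasurable_cintegral_param (lam n) (h := fun z : (R * 'rV[R]_n) * 'rV[R]_n =>
  expi2pi (dotp z.2 z.1.2) * f (cons_rV (z.1.1, z.2)))).
apply: cmeasurable_funM.
  apply: cmeasurable_expi2pi.
  apply: measurable_dotp; first exact: measurable_snd.
  exact: (measurableT_comp measurable_snd measurable_fst).
have mp : measurable_fun setT (fun z : (R * 'rV[R]_n) * 'rV[R]_n => (z.1.1, z.2)).
  apply: measurable_fun_pair; last exact: measurable_snd.
  exact: (measurableT_comp measurable_fst measurable_fst).
by split; [exact: (measurableT_comp m1 mp)|exact: (measurableT_comp m2 mp)].
Qed.

Let phase w : measurable_fun setT (fun p : R * 'rV[R]_n => dotp p.2 w).
Proof. by apply: measurable_dotp; first exact: measurable_snd. Qed.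

Let F1 w : L1C mu (F ^~ w).
Proof.
apply: (L1C_cintegral1 (m1 := mu) (m2 := lam n)
  (h := fun p : R * 'rV[R]_n => expi2pi (dotp p.2 w) * f (cons_rV p))).
by apply: L1C_expi2piM => //; exact: phase.
Qed.

Let fourier_cons b w : fourier f (cons_rV (b, w)) = fourier_line (F ^~ w) b.
Proof.
have mph : measurable_fun setT (fun p : R * 'rV[R]_n => p.1 * b + dotp p.2 w).
  by apply: measurable_funD; [exact: measurable_funM|exact: phase].
pose h (p : R * 'rV[R]_n) := expi2pi (p.1 * b + dotp p.2 w) * f (cons_rV p).
have h1 : L1C (mu \x lam n)%E h by exact: L1C_expi2piM.
transitivity (cintegral (mu \x lam n)%E setT h).
  have mf : cmeasurable_fun setT (fun x => expi2pi (dotp x (cons_rV (b, w))) * f x).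
    apply: cmeasurable_funM; last exact: L1C_measurable f1.
    by apply: cmeasurable_expi2pi; exact: measurable_dotpr.
  case: mf => mf1 mf2; apply: complex_eq => /=.
    rewrite Rintegral_rVS//; apply: eq_Rintegral => -[a v] _.
    by rewrite dotp_cons.
  rewrite Rintegral_rVS//; apply: eq_Rintegral => -[a v] _.
  by rewrite dotp_cons.
rewrite -cintegral12//.
have ml : cmeasurable_fun setT (fun a => cintegral (lam n) setT (fun v => h (a, v))).
  by apply: cmeasurable_cintegral_param; exact: L1C_measurable h1.
have mr : cmeasurable_fun setT (fun a : R => expi2pi (a * b) * F a w).
  apply: cmeasurable_funM; last exact: L1C_measurable (F1 w).
  by apply: cmeasurable_expi2pi; exact: measurable_funM.
have E : {ae mu, forall a, cintegral (lam n) setT (fun v => h (a, v)) =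
    expi2pi (a * b) * F a w}.
  apply: ae_imply (ae_L1C_slice fc1) => a fa.
  rewrite -cintegralZ; last first.
    by apply: L1C_expi2piM => //; exact: measurable_dotpr.
  by apply: eq_cintegral => v; rewrite /h /= expi2piD mulrA.
apply: (cintegral_ae_eq (mu := mu)); [exact: ml|exact: mr|exact: E].
Qed.

(** Let [F a w] be the transform of the section of [f] at [a]. The induction
    hypothesis bounds the integral of |f|^2 by that of |F|^2, for almost every [a];
    for fixed [w] the inequality on the line bounds the latter by the integral of
    the square of the transform of [F ^~ w], and that transform is the one of [f]. *)
Lemma plancherel_le_step :
  (\int[lam n.+1]_x (normc (f x) ^+ 2)%:E <=
   \int[lam n.+1]_x (normc (fourier f x) ^+ 2)%:E)%E.
Proof.
have mf := L1C_measurable f1.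
have mN : measurable_fun setT (fun z : R * 'rV[R]_n => (normc (F z.1 z.2) ^+ 2)%:E).
  by apply/measurable_EFinP; exact: (measurable_sqr_normc mF).
have mc : measurable_fun setT (fun p : R * 'rV[R]_n => (normc (f (cons_rV p)) ^+ 2)%:E).
  apply/measurable_EFinP; apply: measurable_sqr_normc; exact: L1C_measurable fc1.
have mf2 : measurable_fun setT (fun x => (normc (fourier f x) ^+ 2)%:E).
  by apply/measurable_EFinP/measurable_sqr_normc; exact: measurable_fourier.
rewrite ge0_integral_rVS12; last 2 first.
- by apply/measurable_EFinP; exact: measurable_sqr_normc.
- by move=> x; rewrite lee_fin sqr_ge0.
apply: (@le_trans _ _ (\int[mu]_a \int[lam n]_w (normc (F a w) ^+ 2)%:E)%E).
  apply: ae_ge0_le_integral => //.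
  - by move=> a _; apply: integral_ge0 => v _; rewrite lee_fin sqr_ge0.
  - apply: (measurable_fun_fubini_tonelli_F (m2 := lam n)
      (fun p : R * 'rV[R]_n => (normc (f (cons_rV p)) ^+ 2)%:E)) => //.
    by move=> p; rewrite lee_fin sqr_ge0.
  - by move=> a _; apply: integral_ge0 => v _; rewrite lee_fin sqr_ge0.
  - apply: (measurable_fun_fubini_tonelli_F (m2 := lam n)
      (fun z : R * 'rV[R]_n => (normc (F z.1 z.2) ^+ 2)%:E)) => //.
    by move=> p; rewrite lee_fin sqr_ge0.
  by apply: ae_imply (ae_L1C_slice fc1) => a fa _; exact: IH.
rewrite (fubini_tonelli (m1 := mu) (m2 := lam n)
  (fun z : R * 'rV[R]_n => (normc (F z.1 z.2) ^+ 2)%:E))//; last first.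
  by move=> z; rewrite lee_fin sqr_ge0.
rewrite (ge0_integral_rVS21 mf2); last by move=> x; rewrite lee_fin sqr_ge0.
apply: ge0_le_integral; first exact: measurableT.
- by move=> w _; apply: integral_ge0 => a _; rewrite lee_fin sqr_ge0.
- apply: (measurable_fun_fubini_tonelli_G (m1 := mu)
    (fun z : R * 'rV[R]_n => (normc (F z.1 z.2) ^+ 2)%:E)) => //.
  by move=> z; rewrite lee_fin sqr_ge0.
- apply: (measurable_fun_fubini_tonelli_G (m1 := mu)
    (fun p : R * 'rV[R]_n => (normc (fourier f (cons_rV p)) ^+ 2)%:E)) => //.
    exact: (measurableT_comp mf2 (@measurable_cons_rV R n)).
  by move=> z; rewrite lee_fin sqr_ge0.
move=> w _; apply: (le_trans (plancherel_le_line (F1 w))).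
rewrite le_eqVlt; apply/orP; left; apply/eqP.
by apply: eq_integral => b _; rewrite fourier_cons.
Qed.

End step.

(** The Lebesgue measure of R^0 is the Dirac mass at its only point. *)
Lemma fourier_rV0 (f : 'rV[R]_0 -> R[i]) y : fourier f y = f y.
Proof.
have y0 (x : 'rV[R]_0) : x = 0 by apply/rowP => -[].
have mall (g : 'rV[R]_0 -> \bar R) : measurable_fun setT g.
  by rewrite (_ : g = cst (g 0)); [exact: measurable_cst|apply/funext => x; rewrite (y0 x)].
have rint (g : 'rV[R]_0 -> R) : \int[lam 0]_x g x = g y.
  by rewrite /Rintegral integral_dirac// diracT mul1e (y0 y).
have dotp0 (u v : 'rV[R]_0) : dotp u v = 0 by rewrite /dotp big_ord0.
apply: complex_eq; rewrite /= rint.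
  by rewrite Re_expi2piM dotp0 mulr0 cos0 sin0 mulr1 mulr0 subr0.
by rewrite Im_expi2piM dotp0 mulr0 cos0 sin0 mulr1 mulr0 addr0.
Qed.

(** Both sides may be infinite. *)
Theorem plancherel_le n (f : 'rV[R]_n -> R[i]) : L1C (lam n) f ->
  (\int[lam n]_x (normc (f x) ^+ 2)%:E <= \int[lam n]_x (normc (fourier f x) ^+ 2)%:E)%E.
Proof.
elim: n f => [|n IH] f f1; last exact: plancherel_le_step.
rewrite le_eqVlt; apply/orP; left; apply/eqP.
by apply: eq_integral => x _; rewrite fourier_rV0.
Qed.

End plancherel_rV.

(** * Bounds on square norms *)

Section square_norm.
Context d (T : measurableType d) (R : realType) (mu : {measure set T -> \bar R}).
Variable D : set T.
Hypothesis mD : measurable D.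
Implicit Types f g : T -> R[i].

Definition sqint f : \bar R := (\int[mu]_(x in D) (normc (f x) ^+ 2)%:E)%E.

Lemma normc_ge0 (z : R[i]) : 0 <= normc z.
Proof. by case: z => a b; exact: sqrtr_ge0. Qed.

Lemma sqint_ge0 f : (0 <= sqint f)%E.
Proof. by apply: integral_ge0 => x _; rewrite lee_fin sqr_ge0. Qed.

Lemma cLnorm2E f : cLnorm mu 2%:E D f = (sqint f `^ 2^-1)%E.
Proof.
rewrite /cLnorm unlock; congr (_ `^ _)%E; rewrite [RHS]integral_mkcond.
apply: eq_integral => x _; rewrite !patchE; case: ifPn => _.
  rewrite gee0_abs ?lee_fin ?normc_ge0// poweR_EFin; congr EFin.
  by rewrite powR_mulrn// normc_ge0.
change (`|0%:E| `^ 2 = 0%:E :> \bar R)%E.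
by rewrite abse0 poweR_EFin powR0// pnatr_eq0.
Qed.

Lemma sqintE f : sqint f = (cLnorm mu 2%:E D f `^ 2)%E.
Proof. by rewrite cLnorm2E -poweRrM mulVf ?pnatr_eq0// poweRe1// sqint_ge0. Qed.

(** The norm is the square root of [sqint], which is the form in which integrals
    are estimated. *)
Lemma cLnorm_leP f (r : R) : 0 <= r ->
  (cLnorm mu 2%:E D f <= r%:E)%E <-> (sqint f <= (r ^+ 2)%:E)%E.
Proof.
move=> r0; split => h.
  rewrite sqintE -powR_mulrn// -poweR_EFin; apply: gt0_ler_poweR => //.
  - by rewrite in_itv /= leey andbT cLnorm2E poweR_ge0.
  - by rewrite in_itv /= leey lee_fin r0.
rewrite cLnorm2E -[in leRHS](ger0_norm r0) -sqrtr_sqr -powR12_sqrt ?sqr_ge0//.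
rewrite -poweR_EFin; apply: gt0_ler_poweR => //.
- by rewrite in_itv /= leey sqint_ge0.
- by rewrite in_itv /= leey lee_fin sqr_ge0.
Qed.

Lemma measurable_normc f : cmeasurable_fun setT f ->
  measurable_fun setT (fun x => normc (f x)).
Proof.
move=> [f1 f2]; rewrite (_ : (fun x => _) =
    fun x => Num.sqrt (complex.Re (f x) ^+ 2 + complex.Im (f x) ^+ 2)); last first.
  by apply/funext => x; case: (f x).
apply: measurableT_comp.
  apply: continuous_measurable_fun; exact: sqrt_continuous.
by apply: measurable_funD; apply: measurable_funX.
Qed.

Lemma le_cLnorm f g : cmeasurable_fun setT f -> cmeasurable_fun setT g ->
  (forall x, D x -> normc (f x) <= normc (g x)) ->
  (cLnorm mu 2%:E D f <= cLnorm mu 2%:E D g)%E.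
Proof.
move=> mf mg fg; rewrite !cLnorm2E; apply: gt0_ler_poweR.
- by rewrite invr_ge0.
- by rewrite in_itv /= leey sqint_ge0.
- by rewrite in_itv /= leey sqint_ge0.
apply: ge0_le_integral => //.
- by move=> x _; rewrite lee_fin sqr_ge0.
- by apply/measurable_EFinP/measurable_funTS; exact: measurable_sqr_normc.
- by apply/measurable_EFinP/measurable_funTS; exact: measurable_sqr_normc.
by move=> x Dx; rewrite lee_fin lerXn2r ?nnegrE ?normc_ge0//; exact: fg.
Qed.

Lemma cLnormD f g : cmeasurable_fun setT f -> cmeasurable_fun setT g ->
  (cLnorm mu 2%:E D (fun x => (f x + g x)%R) <=
   cLnorm mu 2%:E D f + cLnorm mu 2%:E D g)%E.
Proof.
move=> mf mg.
have mn (h : T -> R[i]) : cmeasurable_fun setT h ->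
    measurable_fun setT ((fun x => normc (h x)) \_ D).
  move=> mh; apply/(measurable_restrictT _ mD).1; apply: measurable_funTS.
  exact: measurable_normc.
have E h : cLnorm mu 2%:E D h = 'N[mu]_2%:E[EFin \o ((fun x => normc (h x)) \_ D)]%E.
  by rewrite -restrict_EFin.
have := minkowski_EFin mu (mn _ mf) (mn _ mg) (ler1n R 2).
rewrite -!E; apply: le_trans.
pose h x : R[i] := (normc (f x) + normc (g x))%:C.
have mh : cmeasurable_fun setT h.
  split => /=; last exact: measurable_cst.
  by apply: measurable_funD; exact: measurable_normc.
have nh x : normc (h x) = normc (f x) + normc (g x).
  by rewrite /h /= expr0n addr0 sqrtr_sqr ger0_norm// addr_ge0 ?normc_ge0.
apply: (@le_trans _ _ (cLnorm mu 2%:E D h)).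
  apply: le_cLnorm => //; first exact: cmeasurable_funD.
  by move=> x _; rewrite nh le_normcD.
have hE : (fun x => normc (h x)) \_ D =
    ((fun x => normc (f x)) \_ D \+ (fun x => normc (g x)) \_ D)%R.
  have -> : (fun x => normc (h x)) = (fun x => normc (f x) + normc (g x)).
    by apply/funext => x; rewrite nh.
  apply/funext => x /=; rewrite !patchE; case: ifP => _ //.
  by rewrite -[RHS]/(0 + 0) addr0.
by rewrite E hE.
Qed.

Definition L2le f (r : R) := (cLnorm mu 2%:E D f <= r%:E)%E.

Lemma L2le_trans f r s : L2le f r -> r <= s -> L2le f s.
Proof. by move=> fr rs; apply: (le_trans fr); rewrite lee_fin. Qed.

Lemma L2leD f g r s : cmeasurable_fun setT f -> cmeasurable_fun setT g ->
  L2le f r -> L2le g s -> L2le (fun x => f x + g x) (r + s).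
Proof.
move=> mf mg fr gs; apply: (le_trans (cLnormD mf mg)).
rewrite /L2le in fr gs; apply: (le_trans (leeD fr gs)).
by rewrite EFinD.
Qed.

Lemma L2le_mul f g (c r : R) : cmeasurable_fun setT f -> cmeasurable_fun setT g ->
  0 <= c -> 0 <= r -> (forall x, D x -> normc (f x) <= c * normc (g x)) ->
  L2le g r -> L2le f (c * r).
Proof.
move=> mf mg c0 r0 fg gr; apply/cLnorm_leP; first exact: mulr_ge0.
move/cLnorm_leP : gr => /(_ r0) gr.
apply: (@le_trans _ _ (\int[mu]_(x in D) ((c ^+ 2)%:E * (normc (g x) ^+ 2)%:E))%E).
  apply: ge0_le_integral => //.
  - by move=> x _; rewrite lee_fin sqr_ge0.
  - by apply/measurable_EFinP/measurable_funTS; exact: measurable_sqr_normc.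
  - apply/measurable_EFinP/measurable_funTS; apply: measurable_funM => //.
    exact: measurable_sqr_normc.
  by move=> x Dx; rewrite -EFinM lee_fin -exprMn lerXn2r ?nnegrE ?mulr_ge0 ?normc_ge0//; exact: fg.
rewrite ge0_integralZl//; last 3 first.
- by apply/measurable_EFinP/measurable_funTS; exact: measurable_sqr_normc.
- by move=> x _; rewrite lee_fin sqr_ge0.
- by rewrite lee_fin sqr_ge0.
rewrite exprMn [in leRHS]EFinM; apply: lee_pmul => //.
  by rewrite lee_fin sqr_ge0.
exact: sqint_ge0.
Qed.

Lemma eq_L2le f g r : (forall x, D x -> f x = g x) -> L2le f r -> L2le g r.
Proof.
move=> fg; rewrite /L2le !cLnorm2E; suff -> : sqint f = sqint g by [].
by apply: eq_integral => x; rewrite inE => Dx; rewrite fg.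
Qed.

Lemma L2le0 : L2le (fun=> 0) 0.
Proof.
apply/cLnorm_leP => //; rewrite /sqint.
by under eq_integral do rewrite normc0 expr0n; rewrite integral0 expr0n.
Qed.

Lemma cmeasurable_sum (I : Type) (s : seq I) (f : I -> T -> R[i]) :
  (forall i, cmeasurable_fun setT (f i)) ->
  cmeasurable_fun setT (fun x => \sum_(i <- s) f i x).
Proof.
move=> mf; elim: s => [|i s IH].
  by under [X in cmeasurable_fun _ X]eq_fun do rewrite big_nil; exact: cmeasurable_cst.
under [X in cmeasurable_fun _ X]eq_fun do rewrite big_cons.
exact: cmeasurable_funD.
Qed.

Lemma L2le_sum (I : Type) (s : seq I) (f : I -> T -> R[i]) (r : I -> R) :
  (forall i, cmeasurable_fun setT (f i)) -> (forall i, L2le (f i) (r i)) ->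
  L2le (fun x => \sum_(i <- s) f i x) (\sum_(i <- s) r i).
Proof.
move=> mf fr; elim: s => [|i s IH].
  by rewrite big_nil; apply: eq_L2le L2le0 => x _; rewrite big_nil.
rewrite big_cons.
apply: (@eq_L2le (fun x => f i x + \sum_(j <- s) f j x)).
  by move=> x _; rewrite big_cons.
by apply: L2leD => //; exact: cmeasurable_sum.
Qed.

(** Lower semicontinuity of the norm, by Fatou's lemma. *)
Lemma L2le_lim (fn : nat -> T -> R[i]) f r : 0 <= r ->
  (forall n, cmeasurable_fun setT (fn n)) -> cmeasurable_fun setT f ->
  (forall x, complex.Re (fn n x) @[n --> \oo] --> complex.Re (f x)) ->
  (forall x, complex.Im (fn n x) @[n --> \oo] --> complex.Im (f x)) ->
  (forall n, L2le (fn n) r) -> L2le f r.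
Proof.
move=> r0 mfn mf cre cim fr; apply/cLnorm_leP => //; rewrite /sqint integral_mkcond.
have mp (h : T -> R[i]) : cmeasurable_fun setT h ->
    measurable_fun setT ((fun x => (normc (h x) ^+ 2)%:E) \_ D).
  move=> mh; apply: measurable_patch => //; apply/measurable_EFinP/measurable_funTS.
  exact: measurable_sqr_normc.
apply: (fatou_le (mu := mu) (g := fun n => (fun x => (normc (fn n x) ^+ 2)%:E) \_ D)).
- by move=> n; exact: mp.
- exact: mp.
- by move=> n x; rewrite patchE; case: ifP => // _; rewrite lee_fin sqr_ge0.
- apply: nearW => x; rewrite patchE; under eq_fun do rewrite patchE.
  case: ifP => _; last exact: cvg_cst.
  apply: cvg_EFin; first exact: nearW.
  under eq_fun do rewrite sqr_normcE; rewrite sqr_normcE.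
  by apply: cvgD; rewrite expr2; under eq_fun do rewrite expr2; exact: cvgM.
- by move=> n; rewrite -integral_mkcond; apply/(cLnorm_leP _ r0); exact: fr.
Qed.

End square_norm.

(** * Perturbation of a family of exponentials *)

Section exponential_series.
Context (R : realType).
Implicit Types s x y : R.

(** The coefficient (2 pi i)^m / m! of s^m in the expansion of [expi2pi s], written
    with the coefficient sequences of the cosine and of the sine. *)
Definition exp_coef m : R[i] := cos_coeff (2 * pi) m +i* sin_coeff (2 * pi) m.

Lemma normc_exp_coef m : normc (exp_coef m) = (2 * pi) ^+ m / m`!%:R.
Proof.
have p0 : 0 <= (2 * pi) ^+ m / m`!%:R :> R by rewrite divr_ge0// exprn_ge0// mulr_ge0// pi_ge0.
rewrite /= /cos_coeff /sin_coeff /=.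
case: (odd m); rewrite /= !(mul0r, mul1r, expr0n, addr0, add0r) /= -mulrA exprMn;
  by rewrite sqrr_sign mul1r sqrtr_sqr ger0_norm.
Qed.

Lemma cos_coeffM a s m : cos_coeff (a * s) m = cos_coeff a m * s ^+ m :> R.
Proof. by rewrite /cos_coeff /= exprMn; ring. Qed.

Lemma sin_coeffM a s m : sin_coeff (a * s) m = sin_coeff a m * s ^+ m :> R.
Proof. by rewrite /sin_coeff /= exprMn; ring. Qed.

Lemma exp_coef_term s m : exp_coef m * (s ^+ m)%:C =
  cos_coeff (2 * pi * s) m +i* sin_coeff (2 * pi * s) m.
Proof. by apply: complex_eq; rewrite ?ReM ?ImM /= ?cos_coeffM ?sin_coeffM; ring. Qed.

Lemma Re_sum (I : Type) (r : seq I) (F : I -> R[i]) :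
  complex.Re (\sum_(i <- r) F i) = \sum_(i <- r) complex.Re (F i).
Proof. by elim: r => [|i r IH]; rewrite ?big_nil// !big_cons ReD IH. Qed.

Lemma Im_sum (I : Type) (r : seq I) (F : I -> R[i]) :
  complex.Im (\sum_(i <- r) F i) = \sum_(i <- r) complex.Im (F i).
Proof. by elim: r => [|i r IH]; rewrite ?big_nil// !big_cons ImD IH. Qed.

Lemma cvg_Re_exp_series s :
  complex.Re (\sum_(0 <= m < n.+1) exp_coef m * (s ^+ m)%:C) @[n --> \oo] -->
  complex.Re (expi2pi s).
Proof.
have H : series (cos_coeff (2 * pi * s)) @ \oo --> cos (2 * pi * s).
  by rewrite unlock; exact: (@is_cvg_series_cos_coeff R).
rewrite -cvg_shiftS in H; apply: cvg_trans H.
by under eq_fun do (rewrite Re_sum; under eq_bigr do rewrite exp_coef_term).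
Qed.

Lemma cvg_Im_exp_series s :
  complex.Im (\sum_(0 <= m < n.+1) exp_coef m * (s ^+ m)%:C) @[n --> \oo] -->
  complex.Im (expi2pi s).
Proof.
have H : series (sin_coeff (2 * pi * s)) @ \oo --> sin (2 * pi * s).
  by rewrite unlock; exact: (@is_cvg_series_sin_coeff R).
rewrite -cvg_shiftS in H; apply: cvg_trans H.
by under eq_fun do (rewrite Im_sum; under eq_bigr do rewrite exp_coef_term).
Qed.

Lemma exp_series_le y n : 0 <= y ->
  \sum_(0 <= m < n) y ^+ m.+1 / m.+1`!%:R <= expR y - 1.
Proof.
move=> y0; rewrite lerBrDr.
have -> : \sum_(0 <= m < n) y ^+ m.+1 / m.+1`!%:R + 1 = series (exp_coeff y) n.+1.
  by rewrite /series /= big_nat_recl//= /exp_coeff /= expr0 fact0 divr1 addrC.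
apply: nondecreasing_cvgn_le; last exact: is_cvg_series_exp_coeff.
apply/nondecreasing_seqP => m; rewrite /series /= big_nat_recr//= lerDl.
exact: exp_coeff_ge0.
Qed.

End exponential_series.

Section complex_limits.
Context (R : realType).
Implicit Types (u v : nat -> R[i]) (k l : R[i]).

(** Convergence of complex sequences, through real and imaginary parts. *)
Definition ccvg u l := complex.Re (u n) @[n --> \oo] --> complex.Re l /\
  complex.Im (u n) @[n --> \oo] --> complex.Im l.

Lemma ccvg_cst l : ccvg (fun=> l) l.
Proof. by split; exact: cvg_cst. Qed.

Lemma ccvgD u v k l : ccvg u k -> ccvg v l -> ccvg (fun n => u n + v n) (k + l).
Proof.
move=> [u1 u2] [v1 v2]; split.
  by rewrite ReD; under eq_fun do rewrite ReD; exact: cvgD.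
by rewrite ImD; under eq_fun do rewrite ImD; exact: cvgD.
Qed.

Lemma ccvgM u v k l : ccvg u k -> ccvg v l -> ccvg (fun n => u n * v n) (k * l).
Proof.
move=> [u1 u2] [v1 v2]; split.
  by rewrite ReM; under eq_fun do rewrite ReM; apply: cvgB; exact: cvgM.
by rewrite ImM; under eq_fun do rewrite ImM; apply: cvgD; exact: cvgM.
Qed.

Lemma ccvg_sum (I : Type) (r : seq I) (F : I -> nat -> R[i]) (l : I -> R[i]) :
  (forall i, ccvg (F i) (l i)) ->
  ccvg (fun n => \sum_(i <- r) F i n) (\sum_(i <- r) l i).
Proof.
move=> Fl; elim: r => [|i r IH].
  by rewrite big_nil; under eq_fun do rewrite big_nil; exact: ccvg_cst.
by rewrite big_cons; under eq_fun do rewrite big_cons; exact: ccvgD.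
Qed.

End complex_limits.

Section exponential_perturbation.
Context (R : realType) (d : nat) (I : choiceType).
Notation lam := (lebesgue_rV d : {measure set 'rV[R]_d -> \bar R}).
Variables (D : set 'rV[R]_d) (w : I -> 'rV[R]_d) (B : R).
Hypothesis mD : measurable D.
Hypothesis B0 : 0 <= B.
Let e (j : I) (t : 'rV[R]_d) : R[i] := expi2pi (dotp (w j) t).
Hypothesis wB : forall (J : {fset I}) (b : I -> R[i]),
  L2le lam D (lincomb e J b) (B * l2norm J b).

Variables (z : I -> 'rV[R]_d) (tau : 'rV[R]_d -> 'rV[R]_d) (delta M : R).
Hypothesis mtau : measurable_fun setT tau.
Hypothesis delta0 : 0 <= delta.
Hypothesis M0 : 0 <= M.
Hypothesis zd : forall j i, `|z j ord0 i| <= delta.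
Hypothesis tauM : forall t i, D t -> `|tau t ord0 i| <= M.

Lemma cmeasurable_exponential (v : 'rV[R]_d) :
  cmeasurable_fun setT (fun t : 'rV[R]_d => expi2pi (dotp v t)).
Proof. by apply: cmeasurable_expi2pi; apply: measurable_dotp. Qed.

Lemma l2norm_ge0 (J : {fset I}) (b : I -> R[i]) : 0 <= l2norm J b.
Proof. exact: sqrtr_ge0. Qed.

Lemma l2norm_le (J : {fset I}) (b b' : I -> R[i]) (c : R) : 0 <= c ->
  (forall j, normc (b' j) <= c * normc (b j)) -> l2norm J b' <= c * l2norm J b.
Proof.
move=> c0 bb; rewrite /l2norm -[X in X * _](ger0_norm c0) -sqrtr_sqr -sqrtrM ?sqr_ge0//.
apply: ler_wsqrtr; rewrite mulr_sumr; apply: ler_sum => j _.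
by rewrite -exprMn lerXn2r ?nnegrE ?mulr_ge0 ?normc_ge0.
Qed.

Let moment m (J : {fset I}) (b : I -> R[i]) (t : 'rV[R]_d) : R[i] :=
  \sum_(j <- J) b j * e j t * ((dotp (z j) (tau t)) ^+ m)%:C.

Let mmoment m J b : cmeasurable_fun setT (moment m J b).
Proof.
apply: cmeasurable_sum => j; apply: cmeasurable_funM.
  by apply: cmeasurable_funM; [exact: cmeasurable_cst|exact: cmeasurable_exponential].
split => /=; last exact: measurable_cst.
by apply: measurable_funX; apply: measurable_dotp.
Qed.

Lemma normc_real (r : R) : normc (r%:C) = `|r|.
Proof. by rewrite /= expr0n addr0 sqrtr_sqr. Qed.

Let moment_le m J b : L2le lam D (moment m J b) (B * (d%:R * M * delta) ^+ m * l2norm J b).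
Proof.
elim: m b => [|m IH] b.
  rewrite expr0 mulr1; apply: eq_L2le (wB J b) => t _.
  by apply: eq_bigr => j _; rewrite expr0 mulr1.
(* One coordinate of [z j] is absorbed into the coefficients. *)
pose b' i (j : I) := b j * (z j ord0 i)%:C.
have l2b i : l2norm J (b' i) <= delta * l2norm J b.
  apply: l2norm_le => // j; rewrite /b' normcM normc_real mulrC.
  by rewrite ler_wpM2r// normc_ge0.
pose s := B * (d%:R * M * delta) ^+ m.
have s0 : 0 <= s by rewrite mulr_ge0// exprn_ge0// !mulr_ge0.
have mt i : cmeasurable_fun setT (fun t => (tau t ord0 i)%:C * moment m J (b' i) t).
  apply: cmeasurable_funM => //; split => /=; last exact: measurable_cst.
  exact: (measurableT_comp (measurable_coord_rV i) mtau).
have H i : L2le lam D (fun t => (tau t ord0 i)%:C * moment m J (b' i) t)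
    (M * (s * (delta * l2norm J b))).
  apply: (L2le_mul mD (mt i) (mmoment m J (b' i))) => //.
  - by apply: mulr_ge0 => //; apply: mulr_ge0 => //; exact: l2norm_ge0.
  - move=> t Dt; rewrite normcM normc_real ler_wpM2r ?normc_ge0//; exact: tauM.
  - by apply: L2le_trans (IH _) _; rewrite ler_wpM2l.
have := L2le_sum mD (index_enum 'I_d) mt H.
rewrite sumr_const card_ord => HS.
apply: (L2le_trans (r := M * (s * (delta * l2norm J b)) *+ d)); last first.
  by rewrite -mulr_natl exprS /s le_eqVlt; apply/orP; left; apply/eqP; ring.
apply: eq_L2le HS => t _; rewrite /moment /=.
under eq_bigr do rewrite mulr_sumr.
rewrite exchange_big /=; apply: eq_bigr => j _.
rewrite exprS rmorphM /= {2}/dotp rmorph_sum /= mulr_suml mulr_sumr.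
by apply: eq_bigr => i _; rewrite /b' rmorphM /=; ring.
Qed.

(** Expanding the exponential of [dotp (z j) (tau t)] gives the series of the
    moments \sum_j b_j e_j(t) (z_j . tau(t))^m, for m >= 1. By [moment_le] the m-th
    one has norm at most B (d M delta)^m |b|: writing one factor z_j . tau(t) as a
    sum over the coordinates i, the number tau(t)_i, of modulus at most M, comes
    out, and the number (z_j)_i, of modulus at most delta, goes into the
    coefficients. The exponential series sums these bounds. *)
Lemma exponential_perturbation (J : {fset I}) (b : I -> R[i]) :
  L2le lam D (fun t => \sum_(j <- J) b j * e j t * (expi2pi (dotp (z j) (tau t)) - 1))
    (B * (expR (2 * pi * (d%:R * M * delta)) - 1) * l2norm J b).
Proof.
pose y : R := 2 * pi * (d%:R * M * delta).
have y0 : 0 <= y by rewrite !mulr_ge0// pi_ge0.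
pose P n t := \sum_(0 <= m < n) exp_coef R m.+1 * moment m.+1 J b t.
have mterm m : cmeasurable_fun setT (fun t => exp_coef R m.+1 * moment m.+1 J b t).
  by apply: cmeasurable_funM => //; exact: cmeasurable_cst.
have mP n : cmeasurable_fun setT (P n) by exact: cmeasurable_sum.
have PE n t : P n t = \sum_(j <- J) b j * e j t *
    (\sum_(0 <= m < n.+1) exp_coef R m * ((dotp (z j) (tau t)) ^+ m)%:C - 1).
  rewrite /P; under eq_bigr do rewrite mulr_sumr.
  rewrite exchange_big /=; apply: eq_bigr => j _.
  rewrite big_nat_recl//= expr0.
  have -> : exp_coef R 0 * 1%:C = 1.
    apply: complex_eq; rewrite ?ReM ?ImM /= /cos_coeff /sin_coeff /= !expr0 fact0 divr1.
      by rewrite !mulr1 mulr0 subr0.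
    by rewrite !mul0r mulr0 addr0.
  rewrite addrAC subrr add0r mulr_sumr; apply: eq_bigr => m _.
  by rewrite mulrCA.
have Pcvg t : ccvg (P ^~ t)
    (\sum_(j <- J) b j * e j t * (expi2pi (dotp (z j) (tau t)) - 1)).
  under eq_fun do rewrite PE; apply: ccvg_sum => j.
  apply: ccvgM; first exact: ccvg_cst.
  apply: ccvgD; last exact: ccvg_cst.
  by split; [exact: cvg_Re_exp_series|exact: cvg_Im_exp_series].
apply: (L2le_lim mD (fn := P)) => //.
- apply: mulr_ge0; last exact: l2norm_ge0.
  by apply: mulr_ge0 => //; rewrite subr_ge0 -[leLHS]expR0 ler_expR.
- apply: cmeasurable_sum => j; apply: cmeasurable_funM.
    by apply: cmeasurable_funM; [exact: cmeasurable_cst|exact: cmeasurable_exponential].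
  apply: cmeasurable_funD; last exact: cmeasurable_cst.
  by apply: cmeasurable_expi2pi; apply: measurable_dotp.
- by move=> t; have [] := Pcvg t.
- by move=> t; have [] := Pcvg t.
move=> n; apply: (L2le_trans (r := \sum_(0 <= m < n) (y ^+ m.+1 / m.+1`!%:R) * (B * l2norm J b))).
  apply: L2le_sum => // m.
  have -> : y ^+ m.+1 / m.+1`!%:R * (B * l2norm J b) =
      normc (exp_coef R m.+1) * (B * (d%:R * M * delta) ^+ m.+1 * l2norm J b).
    by rewrite normc_exp_coef /y exprMn; ring.
  apply: (L2le_mul mD (mterm m) (mmoment m.+1 J b)) => //.
  - exact: normc_ge0.
  - by rewrite !mulr_ge0// ?l2norm_ge0// exprn_ge0// !mulr_ge0.
  - by move=> t _; rewrite normcM.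
rewrite -mulr_suml.
have -> (E L : R) : B * (E - 1) * L = (E - 1) * (B * L) by ring.
apply: ler_wpM2r.
  by rewrite mulr_ge0// l2norm_ge0.
exact: exp_series_le.
Qed.

End exponential_perturbation.

(** * Fourier transforms of translates *)

Section translates_and_fourier.
Context (R : realType) (d : nat).
Notation lam := (lebesgue_rV d : {measure set 'rV[R]_d -> \bar R}).
Implicit Types (f psi : 'rV[R]_d -> R[i]) (s xi : 'rV[R]_d).

Lemma cLspace1_L1C psi : cLspace lam 1%:E setT psi -> L1C lam psi.
Proof.
move=> [[m1 m2]]; rewrite /cLnorm Lnorm1 patch_setT => H.
have mn : measurable_fun setT (fun x => normc (psi x)) by exact: measurable_normc.
have n1 : L1 lam (fun x => normc (psi x)).
  by apply: L1_fin => //; rewrite (eq_integral (fun x => `|(normc (psi x))%:E|%E)).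
split; apply: (L1_le (mu := lam) (g := fun x => normc (psi x))) => // x;
  case: (psi x) => a b /=; rewrite -sqrtr_sqr ler_wsqrtr//.
  by rewrite lerDl sqr_ge0.
by rewrite lerDr sqr_ge0.
Qed.

Lemma rV_shift_invariant s (f : 'rV[R]_d -> \bar R) : measurable_fun setT f ->
  (forall x, (0 <= f x)%E) ->
  (\int[lam]_x f x = 1%:E * \int[lam]_x f (x + s)%R)%E.
Proof. by move=> mf f0; rewrite mul1e ge0_integral_rV_shift. Qed.

Lemma L1C_shift s f : L1C lam f -> L1C lam (fun x => f (x + s)).
Proof.
move=> [f1 f2]; split.
  exact: (L1_substitution (measurable_shift_rV s) (@rV_shift_invariant s) f1 ltr01).
exact: (L1_substitution (measurable_shift_rV s) (@rV_shift_invariant s) f2 ltr01).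
Qed.

Lemma cintegral_shift s f : L1C lam f ->
  cintegral lam setT (fun x => f (x + s)) = cintegral lam setT f.
Proof.
move=> [f1 f2]; apply: complex_eq => /=.
  by rewrite [RHS](Rintegral_substitution (measurable_shift_rV s)
    (@rV_shift_invariant s) f1 ltr01) mul1r.
by rewrite [RHS](Rintegral_substitution (measurable_shift_rV s)
    (@rV_shift_invariant s) f2 ltr01) mul1r.
Qed.

Lemma dotpDl (u v w : 'rV[R]_d) : dotp (u + v) w = dotp u w + dotp v w.
Proof. by rewrite /dotp -big_split; apply: eq_bigr => i _; rewrite mxE mulrDl. Qed.

Lemma dotpC (u v : 'rV[R]_d) : dotp u v = dotp v u.
Proof. by apply: eq_bigr => i _; rewrite mulrC. Qed.

Lemma dotpDr (u v w : 'rV[R]_d) : dotp u (v + w) = dotp u v + dotp u w.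
Proof. by rewrite !(dotpC u) dotpDl. Qed.

(** Translation turns into a modulation of the transform. *)
Lemma fourier_translate s psi xi : L1C lam psi ->
  fourier (translate s psi) xi = expi2pi (- dotp s xi) * fourier psi xi.
Proof.
move=> p1; rewrite /fourier.
have h1 : L1C lam (fun x => expi2pi (dotp x xi) * psi x).
  by apply: L1C_expi2piM => //; exact: measurable_dotpr.
rewrite -cintegralZ// -[RHS](cintegral_shift s); last exact: L1CZ.
apply: eq_cintegral => x; rewrite mulrA -expi2piD dotpDl.
by rewrite addrC addrK.
Qed.

Lemma L1C0 : L1C lam (fun=> 0).
Proof. by split => /=; exact: integrable0. Qed.

Lemma eq_L1C f g : f =1 g -> L1C lam f -> L1C lam g.
Proof. by move=> /funext ->. Qed.

Lemma L1C_sum (I : choiceType) (e : I -> 'rV[R]_d -> R[i]) (r : seq I) a :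
  (forall j, L1C lam (e j)) -> L1C lam (fun x => \sum_(j <- r) a j * e j x).
Proof.
move=> e1; elim: r => [|j r IH].
  by apply: eq_L1C L1C0 => x; rewrite big_nil.
apply: (@eq_L1C (fun x => a j * e j x + \sum_(i <- r) a i * e i x)).
  by move=> x; rewrite big_cons.
by apply: L1CD => //; exact: L1CZ.
Qed.

Lemma fourier_lincomb (I : choiceType) (e : I -> 'rV[R]_d -> R[i])
    (J : {fset I}) a xi : (forall j, L1C lam (e j)) ->
  fourier (lincomb e J a) xi = \sum_(j <- J) a j * fourier (e j) xi.
Proof.
move=> e1; rewrite /lincomb /fourier; elim: (enum_fset J) => [|j s IH].
  rewrite big_nil; transitivity (cintegral lam setT (fun=> 0 : R[i])).
    by apply: eq_cintegral => x; rewrite big_nil mulr0.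
  by apply: complex_eq; rewrite /= /Rintegral integral0.
have m1 : measurable_fun setT (fun x : 'rV[R]_d => dotp x xi) by exact: measurable_dotpr.
rewrite big_cons -IH -cintegralZ; last exact: L1C_expi2piM.
rewrite -cintegralD; last 2 first.
- by apply: L1CZ; exact: L1C_expi2piM.
- by apply: L1C_expi2piM => //; exact: L1C_sum.
by apply: eq_cintegral => x; rewrite big_cons mulrDr mulrCA.
Qed.

End translates_and_fourier.

(** * The partition into unit cubes *)

Section cube_partition.
Context (R : realType) (d : nat).
Notation lam := (lebesgue_rV d : {measure set 'rV[R]_d -> \bar R}).
Notation K := 'rV[int]_d.

Lemma measurable_ucube : measurable (@ucube R d).
Proof.
rewrite (_ : ucube = [set v : 'rV[R]_d | forall i, `[0, 1[%classic (v ord0 i)]).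
  apply: (measurable_rV_box (A := fun _ : 'I_d => `[0%R, 1%R[%classic : set R)) => i.
  exact: measurable_itv.
by apply/seteqP; split => v /= H i; have := H i; rewrite in_itv.
Qed.

Definition cell (k : K) : set 'rV[R]_d := [set x | ucube (x - rV_of_int k)].

Lemma measurable_cell k : measurable (cell k).
Proof.
rewrite -[X in measurable X]setTI.
exact: (measurable_shift_rV (- rV_of_int k) measurableT measurable_ucube).
Qed.

Lemma cell_inj k l x : cell k x -> cell l x -> k = l.
Proof.
move=> kx lx; apply/rowP => i.
have := kx i; have := lx i; rewrite !mxE => /andP[l0 l1] /andP[k0 k1].
apply/eqP; rewrite eq_le; apply/andP; split; rewrite -ltzD1 -(@ltr_int R) intrD; lra.
Qed.

Lemma cell_cover x : exists k, cell k x.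
Proof.
exists (\row_i Num.floor (x ord0 i)) => i; rewrite !mxE.
have := floor_itv (x ord0 i); rewrite intrD; lra.
Qed.

Lemma integral_cell k (g : 'rV[R]_d -> \bar R) : measurable_fun setT g ->
  (forall x, (0 <= g x)%E) ->
  (\int[lam]_(x in cell k) g x = \int[lam]_(t in ucube) g (t + rV_of_int k)%R)%E.
Proof.
move=> mg g0; rewrite integral_mkcond [RHS]integral_mkcond.
rewrite -(ge0_integral_rV_shift (rV_of_int k)).
- apply: eq_integral => x _; rewrite !patchE.
  suff -> : (x + rV_of_int k \in cell k) = (x \in ucube) by [].
  by apply/idP/idP; rewrite !inE /cell /= addrK.
- by apply: measurable_patch; [exact: measurable_cell|exact: measurable_funTS].
- by move=> x; rewrite patchE; case: ifP.
Qed.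

(** The cells are enumerated through the encoding of integer vectors as natural
    numbers, the numbers that encode no vector getting an empty cell; the
    integral is then the limit of finite sums over distinct cells. *)
Lemma integral_cells_le (g : 'rV[R]_d -> \bar R) (c : \bar R) : measurable_fun setT g ->
  (forall x, (0 <= g x)%E) ->
  (forall s : seq K, uniq s ->
    (\sum_(k <- s) \int[lam]_(t in ucube) g (t + rV_of_int k)%R <= c)%E) ->
  (\int[lam]_x g x <= c)%E.
Proof.
move=> mg g0 H.
pose F n := oapp cell set0 (@pickle_inv K n).
have mF n : measurable (F n).
  by rewrite /F; case: pickle_inv => [k|] /=; [exact: measurable_cell|exact: measurable0].
have TF : \bigcup_n F n = setT.
  apply/seteqP; split => // x _; have [k kx] := cell_cover x.
  by exists (choice.pickle k) => //; rewrite /F pickleK_inv.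
have tF : trivIset setT F.
  apply/trivIsetP => i j _ _ ij; rewrite -subset0 => x [].
  rewrite /F; have := @pickle_invK K i; have := @pickle_invK K j.
  case: (pickle_inv i) => //= k; case: (pickle_inv j) => //= l lj ki kx lx.
  by move: ij; rewrite -ki -lj (cell_inj kx lx) eqxx.
rewrite -TF ge0_integral_bigcup//; last by rewrite TF.
apply: lime_le; first by apply: is_cvg_nneseries => n _ _; exact: integral_ge0.
apply: nearW => n.
have -> : (\sum_(0 <= i < n) \int[lam]_(x in F i) g x =
  \sum_(k <- pmap (@pickle_inv K) (index_iota 0 n))
    \int[lam]_(t in ucube) g (t + rV_of_int k)%R)%E.
  rewrite big_pmap; apply: eq_bigr => i _; rewrite /F.
  by case: (pickle_inv i) => [k|] /=; [rewrite integral_cell|rewrite integral_set0].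
by apply: H; apply: (pmap_uniq (@pickle_invK K)); exact: iota_uniq.
Qed.

Lemma esum_seq_le (S : K -> \bar R) (c : \bar R) (s : seq K) :
  (forall k, (0 <= S k)%E) -> (\esum_(k in setT) S k = c)%E -> uniq s ->
  (\sum_(k <- s) S k <= c)%E.
Proof.
move=> S0 <- us; apply: esum_ge; exists [set` s].
  by split => //; exact: finite_seq.
by rewrite fsbig_seq.
Qed.

(** Some finite partial sum exceeds [c - eps], and adding to it the sum over [s]
    still gives at most [c]. *)
Lemma esum_tail (S : K -> \bar R) (c eps : R) :
  (forall k, (0 <= S k)%E) -> (\esum_(k in setT) S k = c%:E)%E -> 0 < eps ->
  exists2 s0 : seq K, uniq s0 & forall s, uniq s -> {in s, forall k, k \notin s0} ->
    (\sum_(k <- s) S k <= eps%:E)%E.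
Proof.
move=> S0 Sc e0.
have : (c%:E - eps%:E < \esum_(k in setT) S k)%E.
  by rewrite Sc -EFinB lte_fin ltrBlDr ltrDl.
move/ereal_sup_gt => [_ [X [fX _] <-]].
rewrite (fsbig_finite _ _ fX) /= => HX.
exists (finmap.enum_fset (fset_set X)); first exact: finmap.fset_uniq.
move=> s us sX.
have ucat : uniq (finmap.enum_fset (fset_set X) ++ s).
  rewrite cat_uniq finmap.fset_uniq us andbT /=; apply/hasPn => k ks.
  exact: sX.
have := esum_seq_le S0 Sc ucat; rewrite big_cat /= => Hc.
have Xc : (\sum_(k <- finmap.enum_fset (fset_set X)) S k <= c%:E)%E.
  by apply: (esum_seq_le S0 Sc); exact: finmap.fset_uniq.
have sc : (\sum_(k <- s) S k <= c%:E)%E by exact: (esum_seq_le S0 Sc).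
have s0 : (0 <= \sum_(k <- s) S k)%E by apply: sume_ge0.
have X0 : (0 <= \sum_(k <- finmap.enum_fset (fset_set X)) S k)%E by apply: sume_ge0.
move: HX Hc Xc sc s0 X0.
move: (\sum_(k <- _) S k)%E (\sum_(k <- s) S k)%E => [u||] [v||]//=.
rewrite -EFinB -EFinD !lee_fin lte_fin => *; lra.
Qed.

End cube_partition.

(** * Perturbation of a family of translates *)

Section translates_perturbation.
Context (R : realType) (d : nat).
Notation lam := (lebesgue_rV d : {measure set 'rV[R]_d -> \bar R}).
Notation K := 'rV[int]_d.
Implicit Types (J : {fset K}) (a : K -> R[i]).

Lemma coord_le_enorm (v : 'rV[R]_d) i : `|v ord0 i| <= enorm v.
Proof.
rewrite /enorm -sqrtr_sqr; apply: ler_wsqrtr.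
by rewrite (bigD1 i)//= lerDl sumr_ge0// => j _; rewrite sqr_ge0.
Qed.

Lemma normcJ (z : R[i]) : normc (conjc z) = normc z.
Proof. by case: z => u v /=; rewrite sqrrN. Qed.

Lemma expi2piN (s : R) : expi2pi (- s) = conjc (expi2pi s).
Proof. by rewrite /expi2pi /= mulrN cosN sinN. Qed.

Lemma conjcMB (z v w : R[i]) :
  conjc (z * (v - w)) = conjc z * (conjc v - conjc w).
Proof.
by case: z v w => [? ?] [? ?] [? ?]; apply: complex_eq => /=; ring.
Qed.

Lemma fourierB (f g : 'rV[R]_d -> R[i]) xi : L1C lam f -> L1C lam g ->
  fourier (fun t => f t - g t) xi = fourier f xi - fourier g xi.
Proof.
move=> f1 g1.
have m1 : measurable_fun setT (fun x : 'rV[R]_d => dotp x xi) by exact: measurable_dotpr.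
have L h : L1C lam h -> L1C lam (fun x => expi2pi (dotp x xi) * h x).
  by move=> h1; exact: L1C_expi2piM.
rewrite /fourier -[X in _ = _ + X]mulN1r -cintegralZ; last exact: L.
rewrite -cintegralD; [|exact: L|by apply: L1CZ; exact: L].
by apply: eq_cintegral => x; rewrite mulrBr mulN1r.
Qed.

Lemma exists_small_step (c theta : R) : 0 <= c -> 0 < theta ->
  exists2 delta : R, 0 < delta & expR (c * delta) - 1 <= theta.
Proof.
move=> c0 t0; exists (ln (1 + theta) / (c + 1)).
  by rewrite divr_gt0 ?ln_gt0 ?ltrDl// ltr_wpDl.
have l0 : 0 <= ln (1 + theta) by rewrite ln_ge0// lerDl ltW.
have p1 : 0 < 1 + theta by rewrite ltr_wpDl.
have c1 : 0 < c + 1 by rewrite ltr_wpDl.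
rewrite lerBlDr [leRHS]addrC -[leRHS]lnK ?posrE// ler_expR.
by rewrite mulrCA ler_piMr// ler_pdivrMr// mul1r lerDl.
Qed.

Section cube_estimates.
Variables (x y : K -> 'rV[R]_d) (B delta : R).
Hypothesis B0 : 0 <= B.
Hypothesis xB : forall J a,
  L2le lam ucube (lincomb (exponentials x) J a) (B * l2norm J a).
Hypothesis delta0 : 0 <= delta.
Hypothesis yx : forall n i, `|(y n - x n) ord0 i| <= delta.

(** The factor by which the transform of psi is multiplied in that of the
    difference of two combinations of translates. *)
Definition trig_diff J a (xi : 'rV[R]_d) : R[i] :=
  \sum_(j <- J) a j * (expi2pi (- dotp (y j) xi) - expi2pi (- dotp (x j) xi)).

(** The coefficients of the shifted conjugate sum: a shift of the variable by [k]
    multiplies the exponential of frequency [w j] by the unit [expi2pi (w j . k)]. *)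
Definition modulated (w : K -> 'rV[R]_d) a (k : 'rV[R]_d) : K -> R[i] :=
  fun j => conjc (a j) * expi2pi (dotp (w j) k).

Lemma l2norm_modulated w a k J : l2norm J (modulated w a k) = l2norm J a.
Proof.
rewrite /l2norm; congr Num.sqrt; apply: eq_bigr => j _.
by rewrite /modulated normcM normc_expi2pi mulr1 normcJ.
Qed.

Lemma cmeasurable_trig_diff J a k :
  cmeasurable_fun setT (fun t : 'rV[R]_d => trig_diff J a (t + k)).
Proof.
apply: cmeasurable_sum => j; apply: cmeasurable_funM; first exact: cmeasurable_cst.
have me (v : 'rV[R]_d) : cmeasurable_fun setT (fun t : 'rV[R]_d => expi2pi (- dotp v (t + k))).
  apply: cmeasurable_expi2pi.
  have mdk : measurable_fun setT (fun t : 'rV[R]_d => dotp v (t + k)).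
    by apply: measurable_dotp => //; exact: measurable_shift_rV.
  exact: measurable_funN.
have -> : (fun t => expi2pi (- dotp (y j) (t + k)) - expi2pi (- dotp (x j) (t + k))) =
    (fun t => expi2pi (- dotp (y j) (t + k)) + (-1) * expi2pi (- dotp (x j) (t + k))).
  by apply/funext => t; rewrite mulN1r.
apply: cmeasurable_funD => //; apply: cmeasurable_funM => //; exact: cmeasurable_cst.
Qed.

Lemma conj_trig_diff J a xi : conjc (trig_diff J a xi) =
  \sum_(j <- J) conjc (a j) * (expi2pi (dotp (y j) xi) - expi2pi (dotp (x j) xi)).
Proof.
rewrite /trig_diff rmorph_sum; apply: eq_bigr => j _.
by rewrite [LHS]conjcMB -!expi2piN !opprK.
Qed.

Lemma ucube_le1 (t : 'rV[R]_d) i : ucube t -> `|t ord0 i| <= 1.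
Proof. by move=> /(_ i) /andP[t0 t1]; rewrite ger0_norm// ltW. Qed.

Lemma L2le_conj (f g : 'rV[R]_d -> R[i]) (r : R) : cmeasurable_fun setT f ->
  cmeasurable_fun setT g -> 0 <= r -> (forall t, conjc (f t) = g t) ->
  L2le lam ucube g r -> L2le lam ucube f r.
Proof.
move=> mf mg r0 fg gr; rewrite -[r]mul1r; apply: (L2le_mul (@measurable_ucube R d) mf mg) => //.
by move=> t _; rewrite -fg normcJ mul1r.
Qed.

Lemma cmeasurable_lincomb (w : K -> 'rV[R]_d) J a :
  cmeasurable_fun setT (lincomb (exponentials w) J a).
Proof.
apply: cmeasurable_sum => j; apply: cmeasurable_funM; first exact: cmeasurable_cst.
exact: cmeasurable_exponential.
Qed.

Lemma expi2pi_shift (j : K) (t : 'rV[R]_d) :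
  expi2pi (dotp (y j) t) = expi2pi (dotp (x j) t) * expi2pi (dotp (y j - x j) t).
Proof. by rewrite -expi2piD -dotpDl addrC subrK. Qed.

Lemma cmeasurable_conj (f : 'rV[R]_d -> R[i]) : cmeasurable_fun setT f ->
  cmeasurable_fun setT (fun t => conjc (f t)).
Proof.
move=> [f1 f2]; split.
  by rewrite (_ : (fun t => _) = fun t => complex.Re (f t))//; apply/funext => t; case: (f t).
rewrite (_ : (fun t => _) = fun t => - complex.Im (f t)); first exact: measurable_funN.
by apply/funext => t; case: (f t).
Qed.

(** After conjugation and modulation of the coefficients, this is
    [exponential_perturbation] for the shift [tau t = t + k]. *)
Lemma trig_diff_small J a (k : 'rV[R]_d) (M : R) : 0 <= M ->
  (forall i, 1 + `|k ord0 i| <= M) ->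
  L2le lam ucube (fun t => trig_diff J a (t + k))
    (B * (expR (2 * pi * (d%:R * M * delta)) - 1) * l2norm J a).
Proof.
move=> M0 kM.
have tauM t i : ucube t -> `|(t + k) ord0 i| <= M.
  move=> tc; rewrite mxE (le_trans (ler_normD _ _))// (le_trans _ (kM i))//.
  by rewrite lerD2r ucube_le1.
have H := exponential_perturbation (@measurable_ucube R d) B0 xB
  (measurable_shift_rV k) delta0 M0 yx tauM J (modulated x a k).
rewrite l2norm_modulated in H.
apply: L2le_conj H; first exact: cmeasurable_trig_diff.
- have E : (fun t => conjc (trig_diff J a (t + k))) = fun t => \sum_(j <- J)
      modulated x a k j * expi2pi (dotp (x j) t) * (expi2pi (dotp (y j - x j) (t + k)) - 1).
    apply/funext => t; rewrite conj_trig_diff; apply: eq_bigr => j _.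
    by rewrite expi2pi_shift /modulated dotpDr expi2piD; ring.
  by rewrite -E; apply: cmeasurable_conj; exact: cmeasurable_trig_diff.
- apply: mulr_ge0; last exact: l2norm_ge0.
  apply: mulr_ge0 => //; rewrite subr_ge0 -[leLHS]expR0 ler_expR.
  by rewrite !mulr_ge0// pi_ge0.
- move=> t; rewrite conj_trig_diff; apply: eq_bigr => j _.
  by rewrite expi2pi_shift /modulated dotpDr expi2piD; ring.
Qed.

(** The sum with frequencies [y j] is split, by [exponential_perturbation] without
    shift, into the one with frequencies [x j] and a perturbation, each bounded by
    [B]; the third [B] comes from the sum with frequencies [x j] subtracted. The
    bound does not depend on [k]. *)
Lemma trig_diff_bounded J a (k : 'rV[R]_d) :
  expR (2 * pi * (d%:R * delta)) - 1 <= 1 ->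
  L2le lam ucube (fun t => trig_diff J a (t + k)) (3 * B * l2norm J a).
Proof.
move=> e1; pose l := l2norm J a; have l0 : 0 <= l by exact: l2norm_ge0.
have H := exponential_perturbation (@measurable_ucube R d) B0 xB
  (tau := id) (M := 1) (@measurable_id _ _ _) delta0 ler01 yx ucube_le1 J (modulated y a k).
rewrite l2norm_modulated -/l mulr1 in H.
pose P t := \sum_(j <- J) modulated y a k j * expi2pi (dotp (x j) t) *
  (expi2pi (dotp (y j - x j) t) - 1).
have mP : cmeasurable_fun setT P.
  apply: cmeasurable_sum => j; apply: cmeasurable_funM.
    apply: cmeasurable_funM; [exact: cmeasurable_cst|exact: cmeasurable_exponential].
  by apply: cmeasurable_funD; [exact: cmeasurable_exponential|exact: cmeasurable_cst].
have {}H : L2le lam ucube P (B * l).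
  apply: (L2le_trans H); apply: ler_wpM2r => //.
  by rewrite -[leRHS]mulr1 ler_wpM2l.
have H1 := xB J (modulated y a k).
have H2 := xB J (fun j => - modulated x a k j).
have E2 : l2norm J (fun j => - modulated x a k j) = l.
  rewrite /l -(l2norm_modulated x a k) /l2norm; congr Num.sqrt.
  by apply: eq_bigr => j _; rewrite normcN.
rewrite l2norm_modulated -/l in H1; rewrite E2 in H2.
have mD := cmeasurable_funD (cmeasurable_lincomb x J (modulated y a k)) mP.
have H3 := L2leD (@measurable_ucube R d) (cmeasurable_lincomb x J _) mP H1 H.
have H4 := L2leD (@measurable_ucube R d) mD (cmeasurable_lincomb x J _) H3 H2.
rewrite (_ : 3 * B * _ = B * l + B * l + B * l); last by rewrite -/l; ring.
apply: L2le_conj H4.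
- exact: cmeasurable_trig_diff.
- by apply: cmeasurable_funD => //; exact: cmeasurable_lincomb.
- by rewrite !addr_ge0// mulr_ge0.
move=> t; rewrite conj_trig_diff /P /lincomb -!big_split /=; apply: eq_bigr => j _.
by rewrite /exponentials !dotpDr !expi2piD /modulated (expi2pi_shift j t); ring.
Qed.

End cube_estimates.

Section estimate.
Variables (psi : 'rV[R]_d -> R[i]) (x : K -> 'rV[R]_d) (B C : R).
Hypothesis psi1 : L1C lam psi.
Hypothesis psiC : sum_sup_fourier psi = C%:E.
Hypothesis B0 : 0 < B.
Hypothesis xB : forall J a,
  L2le lam ucube (lincomb (exponentials x) J a) (B * l2norm J a).

Let S k := ereal_sup [set (normc (fourier psi (t + rV_of_int k)) ^+ 2)%:E | t in @ucube R d].

Let S_ub k t : ucube t -> ((normc (fourier psi (t + rV_of_int k)) ^+ 2)%:E <= S k)%E.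
Proof. by move=> tc; apply: ereal_sup_ubound; exists t. Qed.

Let S0 k : (0 <= S k)%E.
Proof.
have c0 : @ucube R d 0 by move=> i; rewrite mxE lexx ltr01.
by apply: le_trans (S_ub k c0); rewrite lee_fin sqr_ge0.
Qed.

Let SC : (\esum_(k in setT) S k = C%:E)%E. Proof. exact: psiC. Qed.

Let S_fin k : S k \is a fin_num.
Proof.
rewrite ge0_fin_numE//; apply: (@le_lt_trans _ _ C%:E); last exact: ltry.
have := esum_seq_le S0 SC (s := [:: k]) isT.
by rewrite big_seq1.
Qed.

Let sigma k : R := fine (S k).
Let sigmaE k : S k = (sigma k)%:E. Proof. by rewrite fineK. Qed.
Let sigma0 k : 0 <= sigma k. Proof. exact: fine_ge0. Qed.

Let C0 : 0 <= C.
Proof. by have := esum_seq_le S0 SC (s := [::]) isT; rewrite big_nil lee_fin. Qed.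

Lemma fourier_translates_diff y J a xi :
  fourier (fun t => lincomb (translates psi y) J a t - lincomb (translates psi x) J a t) xi =
  trig_diff x y J a xi * fourier psi xi.
Proof.
have t1 (w : K -> 'rV[R]_d) j : L1C lam (translates psi w j) by exact: L1C_shift.
rewrite fourierB; [|exact: L1C_sum|exact: L1C_sum].
rewrite !fourier_lincomb// /trig_diff mulr_suml -sumrB; apply: eq_bigr => j _.
by rewrite /translates !fourier_translate//; ring.
Qed.

(** Plancherel's inequality and the partition into cubes, the cubes indexed by [s0]
    being estimated by [q0] and the others by [q1]. *)
Lemma sqint_translates_diff y J a (s0 : seq K) (q0 q1 eps : R) :
  0 <= q0 -> 0 <= q1 -> 0 <= eps ->
  uniq s0 ->
  (forall s, uniq s -> {in s, forall k, k \notin s0} -> (\sum_(k <- s) S k <= eps%:E)%E) ->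
  (forall k, k \in s0 -> L2le lam ucube (fun t => trig_diff x y J a (t + rV_of_int k)) q0) ->
  (forall k, L2le lam ucube (fun t => trig_diff x y J a (t + rV_of_int k)) q1) ->
  (sqint lam setT (fun t => lincomb (translates psi y) J a t - lincomb (translates psi x) J a t)%R
    <= (C * q0 ^+ 2 + eps * q1 ^+ 2)%:E)%E.
Proof.
move=> q00 q10 e0 us0 tail small bounded.
pose f t := lincomb (translates psi y) J a t - lincomb (translates psi x) J a t.
have t1 (w : K -> 'rV[R]_d) j : L1C lam (translates psi w j) by exact: L1C_shift.
have f1 : L1C lam f.
  apply: (@eq_L1C _ _ (fun t => lincomb (translates psi y) J a t +
    (-1) * lincomb (translates psi x) J a t)) => [t|]; first by rewrite mulN1r.
  by apply: L1CD; [exact: L1C_sum|apply: L1CZ; exact: L1C_sum].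
apply: (le_trans (plancherel_le f1)).
have mF : measurable_fun setT (fun xi => (normc (fourier f xi) ^+ 2)%:E).
  apply/measurable_EFinP; apply: measurable_sqr_normc; apply: measurable_fourier.
  exact: L1C_measurable f1.
apply: integral_cells_le => //; first by move=> xi; rewrite lee_fin sqr_ge0.
move=> s us.
pose q k := if k \in s0 then q0 else q1.
have cellE k : (\int[lam]_(t in ucube) (normc (fourier f (t + rV_of_int k)%R) ^+ 2)%:E <=
    (sigma k * q k ^+ 2)%:E)%E.
  have qk0 : 0 <= q k by rewrite /q; case: ifP.
  have tq : L2le lam ucube (fun t => trig_diff x y J a (t + rV_of_int k)) (q k).
    by rewrite /q; case: ifP => [/small|_].
  have mt := cmeasurable_trig_diff x y J a (rV_of_int k).
  have mtd : measurable_fun ucube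
      (fun t => (normc (trig_diff x y J a (t + rV_of_int k)) ^+ 2)%:E).
    by apply/measurable_EFinP/measurable_funTS; exact: measurable_sqr_normc.
  move/(cLnorm_leP lam ucube _ qk0) : tq => tq.
  apply: (@le_trans _ _ ((sigma k)%:E *
    sqint lam ucube (fun t => trig_diff x y J a (t + rV_of_int k))%R)%E).
    rewrite /sqint -ge0_integralZl//; last 3 first.
    - exact: measurable_ucube.
    - by move=> t _; rewrite lee_fin sqr_ge0.
    - by rewrite lee_fin.
    apply: ge0_le_integral.
    - exact: measurable_ucube.
    - by move=> t _; rewrite lee_fin sqr_ge0.
    - apply: (measurable_funS measurableT) => //.
      exact: (measurableT_comp mF (measurable_shift_rV (rV_of_int k))).
    - exact: emeasurable_funM.
    move=> t tc; rewrite fourier_translates_diff -EFinM lee_fin normcM exprMn mulrC.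
    apply: ler_wpM2r; first exact: sqr_ge0.
    by have := S_ub k tc; rewrite sigmaE lee_fin.
  by rewrite EFinM; apply: lee_pmul => //; rewrite ?lee_fin// sqint_ge0.
apply: (@le_trans _ _ (\sum_(k <- s) (sigma k * q k ^+ 2)%:E)%E).
  by apply: lee_sum => k _; exact: cellE.
rewrite sumEFin lee_fin (bigID (mem s0)) /=.
have sumS (p : pred K) : (\sum_(k <- s | p k) sigma k)%:E = (\sum_(k <- seq.filter p s) S k)%E.
  by rewrite big_filter -sumEFin; apply: eq_bigr => k _; rewrite sigmaE.
apply: lerD.
  under eq_bigr => k ks do rewrite /q ks.
  rewrite -mulr_suml; apply: ler_wpM2r; first exact: sqr_ge0.
  by rewrite -lee_fin sumS; apply: (esum_seq_le S0 SC); exact: filter_uniq.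
under eq_bigr => k ks do rewrite /q (negbTE ks).
rewrite -mulr_suml; apply: ler_wpM2r; first exact: sqr_ge0.
rewrite -lee_fin sumS; apply: tail; first exact: filter_uniq.
by move=> k; rewrite mem_filter => /andP[].
Qed.

(** [s0] is chosen first, so that the tail beyond it, weighted by the uniform bound
    3 B, contributes half of eta^2; then [delta] is chosen small enough for the
    finitely many cubes of [s0] to contribute at most the other half. *)
Lemma translates_perturbation (eta : R) : 0 < eta ->
  exists2 delta : R, 0 < delta &
    forall y : K -> 'rV[R]_d, (forall n i, `|(y n - x n) ord0 i| <= delta) -> forall J a,
      L2le lam setT
        (fun t => lincomb (translates psi y) J a t - lincomb (translates psi x) J a t)
        (eta * l2norm J a).
Proof.
move=> eta0.
(* The tail counts for eps * (3 * B) ^+ 2 = eta ^+ 2 / 2. *)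
pose eps := eta ^+ 2 / (18 * B ^+ 2).
have eps0 : 0 < eps by rewrite divr_gt0 ?exprn_gt0// mulr_gt0// exprn_gt0.
have [s0 us0 tail] := esum_tail S0 SC eps0.
(* A bound for the coordinates of [t + k], for [t] in the unit cube and [k] in [s0]. *)
pose M : R := 1 + \sum_(k <- s0) \sum_i `|(rV_of_int k : 'rV[R]_d) ord0 i|.
(* theta <= 1 serves the uniform bound, and theta ^+ 2 <= theta the small one; the
   1 added to C avoids a division by 0. *)
pose theta := Num.min 1 (eta ^+ 2 / (2 * (C + 1) * B ^+ 2)).
have C1 : 0 < C + 1 by rewrite ltr_wpDl.
have theta0 : 0 < theta.
  by rewrite lt_min ltr01 divr_gt0 ?exprn_gt0// mulr_gt0 ?exprn_gt0// mulr_gt0.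
have M1 : 1 <= M by rewrite lerDl !sumr_ge0// => k _; rewrite sumr_ge0.
have kM k i : k \in s0 -> 1 + `|(rV_of_int k : 'rV[R]_d) ord0 i| <= M.
  move=> ks; rewrite lerD2l (big_rem _ ks) /= (bigD1 i)//= -addrA lerDl.
  by rewrite addr_ge0 ?sumr_ge0// => l _; rewrite sumr_ge0.
have c0 : 0 <= 2 * pi * (d%:R * M) by rewrite !mulr_ge0// ?pi_ge0// (le_trans ler01).
have [delta delta0 Hd] := exists_small_step c0 theta0.
exists delta => // y yx J a.
pose l := l2norm J a; have l0 : 0 <= l by exact: l2norm_ge0.
have d0 := ltW delta0; have B0' := ltW B0; have t0 := ltW theta0.
have M0 : 0 <= M by exact: le_trans M1.
rewrite -mulrA in Hd.
have small k : k \in s0 ->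
    L2le lam ucube (fun t => trig_diff x y J a (t + rV_of_int k)) (B * theta * l).
  move=> ks; apply: (L2le_trans (trig_diff_small B0' xB d0 yx J a M0 (fun i => kM k i ks))).
  by apply: ler_wpM2r => //; exact: ler_wpM2l.
have bounded k : L2le lam ucube (fun t => trig_diff x y J a (t + rV_of_int k)) (3 * B * l).
  apply: (trig_diff_bounded B0' xB d0 yx).
  apply: (@le_trans _ _ theta); last by rewrite ge_min lexx.
  apply: le_trans Hd; rewrite lerB// ler_expR ler_wpM2l ?mulr_ge0 ?pi_ge0//.
  by rewrite ler_wpM2r// ler_peMr.
apply/cLnorm_leP; first by rewrite mulr_ge0// ltW.
apply: le_trans.
  apply: (sqint_translates_diff _ _ (ltW eps0) us0 tail small bounded).
    by rewrite !mulr_ge0.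
  by rewrite !mulr_ge0.
rewrite lee_fin.
have B2 : 0 < B ^+ 2 by rewrite exprn_gt0.
have epsE : eps * (9 * B ^+ 2) = eta ^+ 2 / 2.
  by rewrite /eps; field; exact: lt0r_neq0.
have thetaE : (C + 1) * B ^+ 2 * theta <= eta ^+ 2 / 2.
  have : theta <= eta ^+ 2 / (2 * (C + 1) * B ^+ 2) by rewrite ge_min lexx orbT.
  rewrite ler_pdivlMr ?mulr_gt0// ler_pdivlMr//.
  by apply: le_trans; rewrite le_eqVlt; apply/orP; left; apply/eqP; ring.
have theta1 : theta <= 1 by rewrite ge_min lexx.
have CE : C * (B ^+ 2 * theta ^+ 2) <= eta ^+ 2 / 2.
  apply: le_trans thetaE; rewrite -mulrA; apply: ler_pM => //.
  - by rewrite mulr_ge0 ?sqr_ge0.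
  - by rewrite lerDl.
  - by rewrite ler_wpM2l ?sqr_ge0// expr2 ler_piMr.
rewrite -/l.
rewrite (_ : C * _ + _ = (C * (B ^+ 2 * theta ^+ 2) + eps * (9 * B ^+ 2)) * l ^+ 2);
  last by ring.
rewrite exprMn; apply: ler_wpM2r; first exact: sqr_ge0.
rewrite epsE; lra.
Qed.

End estimate.
End translates_perturbation.

(** * Stability of the Riesz basis of translates *)

Theorem theorem2 (R : realType) (d : nat) (psi : 'rV[R]_d -> R[i]) (c C : R)
    (x : 'rV[int]_d -> 'rV[R]_d) :
  cLspace (lebesgue_rV d) 1%:E setT psi ->
  cLspace (lebesgue_rV d) 2%:E setT psi ->
  0 < c -> c%:E = sum_inf_fourier psi ->
  c < C -> sum_sup_fourier psi = C%:E ->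
  discrete_family x ->
  exponentials_riesz_basis x ->
  translates_riesz_basis psi x ->
  exists2 delta : R, 0 < delta &
    forall y : 'rV[int]_d -> 'rV[R]_d,
      (ereal_sup [set (enorm (y n - x n))%:E | n in [set: 'rV[int]_d]]
        < delta%:E)%E ->
      translates_riesz_basis psi y.
Proof.
move=> psi1 _ _ _ _ psiC _ [_ [A [B [_ B0 xB]]]] [_ [a [b [a0 b0 xab]]]].
have psiL1 := cLspace1_L1C psi1.
have xB' J u : L2le (lebesgue_rV d) ucube (lincomb (exponentials x) J u) (B * l2norm J u).
  by case: (xB J u).
have a20 : 0 < a / 2 by rewrite divr_gt0.
have [delta delta0 H] := translates_perturbation psiL1 psiC B0 xB' a20.
exists delta => // y yx.
(* The closed span is [V2] by definition. *)
split; first by [].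
have {}yx n i : `|(y n - x n) ord0 i| <= delta.
  apply: (le_trans (coord_le_enorm _ _)); rewrite -lee_fin.
  by apply: le_trans (ltW yx); apply: ereal_sup_ubound; exists n.
have {}H := H y yx.
have mlin (w : 'rV[int]_d -> 'rV[R]_d) J u :
    cmeasurable_fun setT (lincomb (translates psi w) J u).
  by apply: L1C_measurable; apply: L1C_sum => j; exact: L1C_shift.
exists (a / 2), (b + a / 2); split => //; first exact: addr_gt0.
move=> J u; have [xa xb] := xab J u; have {}H := H J u.
pose X := lincomb (translates psi x) J u; pose Y := lincomb (translates psi y) J u.
pose l := l2norm J u; have l0 : 0 <= l by exact: l2norm_ge0.
have mdiff : cmeasurable_fun setT (fun t => Y t - X t).
  have [y1 y2] := mlin y J u; have [x1 x2] := mlin x J u; split.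
    by under eq_fun do rewrite ReB; exact: measurable_funB.
  by under eq_fun do rewrite ImB; exact: measurable_funB.
split; last first.
  apply: (@eq_L2le _ _ _ _ setT (fun t => X t + (Y t - X t))) => [t _|].
    by rewrite addrC subrK.
  rewrite mulrDl; apply: L2leD => //; exact: mlin.
have mN : cmeasurable_fun setT (fun t => X t - Y t).
  have [y1 y2] := mlin y J u; have [x1 x2] := mlin x J u; split.
    by under eq_fun do rewrite ReB; exact: measurable_funB.
  by under eq_fun do rewrite ImB; exact: measurable_funB.
have HN : L2le (lebesgue_rV d) setT (fun t => X t - Y t) (a / 2 * l).
  rewrite -[_ * l]mul1r; apply: (L2le_mul measurableT mN mdiff) => //.
    by rewrite mulr_ge0// ltW.
  by move=> t _; rewrite mul1r -opprB normcN.
have := cLnormD (lebesgue_rV d) measurableT (mlin y J u) mN.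
rewrite (_ : (fun t => _) = X); last by apply/funext => t; rewrite addrC subrK.
move=> /(le_trans xa) /le_trans /(_ (leeD (lexx _) HN)).
rewrite -leeBlDr// -EFinB -/l.
by rewrite [X in (X%:E <= _)%E](_ : _ = a / 2 * l)//; field.
Qed.
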